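(* (a) Let $W$ be an irreducible complex reflection group with Coxeter number $h$ and let $W'\subseteq W$ be an irreducible reflection subgroup with Coxeter number $h'$. Then $h'\le h$, with equality if and only if $W'=W$. (b) Let $W$ be an irreducible well-generated complex reflection group and let $w\in W$ be a Coxeter element. Then for all reflection subgroups $W'\ne W$ of $W$, $w\notin W'$.
   Context: Let $\mathfrak{h}$ be a finite-dimensional complex vector space and $W\subseteq\mathrm{GL}(\mathfrak{h})$ a finite group. Its set of reflections is $R=\{r\in W:\mathrm{codim}(\mathrm{fix}(r))=1\}$, and $\mathcal{A}=\{\mathrm{fix}(r): r\in R\}$ is the set of reflecting hyperplanes. $W$ is a (complex) reflection group if it is generated by $R$, and it is irreducible if $\mathfrak{h}$ is an irreducible $\mathbf{C}W$-module. For an irreducible reflection group $W$, the central element $\sum_{r\in R}(1-r)\in\mathbf{C}W$ acts on $\mathfrak{h}$ by a scalar, called the Coxeter number $h$ of $W$; explicitly $h=(|R|+|\mathcal{A}|)/\dim\mathfrak{h}$. A reflection subgroup of $W$ is a subgroup $W'\subseteq W$ generated by $R'=W'\cap R$. There is a unique $W'$-stable subspace $\mathfrak{h}'\subseteq\mathfrak{h}$ with $\mathfrak{h}=\mathfrak{h}^{W'}\oplus\mathfrak{h}'$; $W'$ is called irreducible if $\mathfrak{h}'$ is an irreducible $\mathbf{C}W'$-module, and its Coxeter number $h'$ is the scalar by which $\sum_{r\in R'}(1-r)$ acts on $\mathfrak{h}'$. For a reflection group $W$ of rank $n=\dim\mathfrak{h}$, the ring of invariants $\mathbf{C}[\mathfrak{h}]^W$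 is a polynomial ring, and the degrees $d_1\le\cdots\le d_n$ of $W$ are the degrees of homogeneous polynomials that are algebraically independent generators of $\mathbf{C}[\mathfrak{h}]^W$. An irreducible complex reflection group is well-generated if it is generated by a subset of $R$ of cardinality $n$. Let $d$ be a positive integer and $\zeta$ a primitive $d$th root of unity. The number $d$ is regular for $W$ if there are a vector $v\in\mathfrak{h}\setminus\bigcup_{H\in\mathcal{A}}H$ and an element $w\in W$ with $wv=\zeta v$; any such $w$ is then called a regular element of order $d$. A Coxeter element of an (irreducible) well-generated complex reflection group is a regular element corresponding to the regular number $d_n$, the largest degree of $W$. *)

(* Defs.v *)
From mathcomp Require Import all_boot all_order all_algebra all_fingroup all_character.
From mathcomp Require Export reals.
From mathcomp.real_closed Require Export complex.
From mathcomp.multinomials Require Export mpoly.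

Set Implicit Arguments.
Unset Strict Implicit.
Unset Printing Implicit Defensive.

Import GroupScope GRing.Theory.
Local Open Scope ring_scope.

(* A finite subgroup of GL(h), with n = dim h, is given by a finite group W    *)
(* together with a faithful representation rW of W on h = 'rV[C]_n.  As        *)
(* everywhere in mxrepresentation, matrices act on row vectors on the right,   *)
(* so that "w v" reads v *m rW w, and a subspace of h is the row space of a    *)
(* square matrix.                                                              *)

Section ReflectionGroups.

Variables (C : fieldType) (gT : finGroupType) (W : {group gT}) (n : nat).
Variable rW : mx_representation C W n.

Definition reflections : {set gT} :=
  [set r in W | (n - \rank (rfix_mx rW [set r]))%N == 1%N].

Definition irreducible_reflection_group : Prop :=
  [/\ mx_faithful rW, mx_irreducible rW & <<reflections>>%g = W].

Definition well_generated : Prop :=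
  exists S : {set gT},
    [/\ S \subset reflections, #|S| = n & <<S>>%g = W].

Definition reflection_subgroup (H : {group gT}) : Prop :=
  H \subset W /\ <<H :&: reflections>>%g = H.

(* The H-stable complement of the fixed space of H in h; it is unique as a     *)
(* subspace, i.e., the matrix U is unique up to equality of row spaces.        *)
Definition stable_complement (H : {group gT}) (sHW : H \subset W)
    (U : 'M[C]_n) : Prop :=
  [/\ mxmodule (subg_repr rW sHW) U,
      (rfix_mx rW H + U :=: 1%:M)%MS
    & mxdirect (rfix_mx rW H + U)%MS].

Definition irreducible_reflection_subgroup (H : {group gT})
    (sHW : H \subset W) (U : 'M[C]_n) : Prop :=
  [/\ reflection_subgroup H, stable_complement sHW U
    & mxsimple (subg_repr rW sHW) U].

(* The scalar c is determined by H and U as soon as U != 0.                    *)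
Definition is_coxeter_number (H : {group gT}) (U : 'M[C]_n) (c : C) : Prop :=
  forall v : 'rV[C]_n, (v <= U)%MS ->
    v *m (\sum_(r in H :&: reflections) (1%:M - rW r)) = c *: v.

(* C[h] is {mpoly C[n]}, with 'X_i the i-th coordinate function on 'rV[C]_n;   *)
(* mpoly_act w p is the polynomial function v |-> p (v *m rW w).               *)
Definition mpoly_act (w : gT) (p : {mpoly C[n]}) : {mpoly C[n]} :=
  p \mPo [tuple \sum_(j < n) rW w j i *: 'X_j | i < n].

Definition mpoly_invariant (p : {mpoly C[n]}) : Prop :=
  forall w, w \in W -> mpoly_act w p = p.

Definition alg_independent (f : n.-tuple {mpoly C[n]}) : Prop :=
  forall q : {mpoly C[n]}, q \mPo f = 0 -> q = 0.

Definition generates_invariants (f : n.-tuple {mpoly C[n]}) : Prop :=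
  forall p : {mpoly C[n]},
    mpoly_invariant p <-> exists q : {mpoly C[n]}, p = q \mPo f.

Definition degrees (d : n.-tuple nat) : Prop :=
  sorted leq d /\
  exists f : n.-tuple {mpoly C[n]},
    [/\ forall i, tnth f i \is (tnth d i).-homog,
        alg_independent f & generates_invariants f].

Definition regular_element (d : nat) (w : gT) : Prop :=
  w \in W /\
  exists2 zeta : C, d.-primitive_root zeta &
  exists2 v : 'rV[C]_n,
    (forall r, r \in reflections -> ~~ (v <= rfix_mx rW [set r])%MS)
    & v *m rW w = zeta *: v.

Definition coxeter_element (w : gT) : Prop :=
  exists2 d : n.-tuple nat, degrees d & regular_element (last 0%N d) w.

End ReflectionGroups.

(* Main.v *)
Require Import Defs.
From mathcomp Require Import all_boot all_order all_algebra all_fingroup all_character.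
From mathcomp Require Import reals.
From mathcomp.real_closed Require Import complex.
From HB Require Import structures.
From mathcomp Require Import boolp zify ring.

(** Part (a). For an invariant Hermitian product, [W] acts by isometries, so that
    [<(1 - r) v, v>] plus its conjugate is [|(1 - r) v|^2] for every [r] in [W].  Let [v]
    be in the nontrivial part [U] of the subgroup.  Summing over the reflections that
    are not in the subgroup, a set closed under inverses, gives
    [2 (h - h') |v|^2 = sum |(1 - r) v|^2 >= 0] ([herm_sum_sub]).  In case of equality
    all these reflections fix [U] pointwise, so [U] is [W]-stable, so it is the whole
    space, and there are no such reflections ([coxeter_number_mono]).

    Part (b). Let [S] be the polynomial ring, [f_1, .., f_n] basic invariants of [W] of
    degrees [d_1 <= .. <= d_n = d], and [w v = zeta v] with [zeta] of order [d] and [v]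
    off the hyperplanes.  Let [H] be a reflection subgroup containing [w].  The proof
    shows that every [H]-invariant is [W]-invariant; as the orbit of [v] is free, [H] is
    then [W] ([regular_subgroup_eq]).  There are three ingredients.

    - The Jacobian of the [f_i] does not vanish at [v] ([jacobian_regular]).  It is not
      in the ideal generated by the [f_i], since it generates the socle of the quotient
      by that ideal ([det_notin_ideal]).  Removing from it all linear factors that are
      root forms leaves an invariant, by unique factorization, and this invariant has a
      nonzero constant term.

    - Call [m] the set of [H]-invariants without constant term.  The [f_i] are linearly
      independent modulo [m^2] ([basic_independent]).  Indeed the restriction of an
      element of [m] to the line through [v] is a polynomial in the [d]-th power of the
      parameter, because [w] is in [H]; so the differential of a product of two elements
      of [m] vanishes to order [d] on this line, while the differential of [f_i] has
      degree [d_i - 1 < d] and the Jacobian is invertible at [v].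

    - Chevalley's argument ([chevalley_relation], [dependent_mod_hilbert]): since [H] is
      generated by reflections, [m / m^2] has dimension at most [n].  It is applied to
      the [f_i] and one more homogeneous [H]-invariant, whose differentials are linearly
      dependent ([invariant_mod_squares]).

    Hence [m] is spanned modulo [m^2] by the [f_i], and induction on the degree finishes
    the proof ([invariant_homog_eq]). *)

Set Implicit Arguments.
Unset Strict Implicit.
Unset Printing Implicit Defensive.
Import GroupScope GRing.Theory Num.Theory.
Local Open Scope ring_scope.

(** * Ideals, congruences and linear forms in polynomial rings *)

(** With [Q] trivial this is the ideal generated by [P]; other choices of [Q]
    give products of ideals, or of sets of invariants. *)
Inductive combination (T : comNzRingType) (Q P : T -> Prop) : T -> Prop :=
| combination0 : combination Q P 0
| combinationD s u p :
    Q s -> P u -> combination Q P p -> combination Q P (s * u + p).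

Definition ideal (T : comNzRingType) (P : T -> Prop) : T -> Prop :=
  combination (fun=> True) P.

Section Combinations.
Variable T : comNzRingType.
Implicit Types (Q P : T -> Prop) (p q : T).

Lemma combination_add Q P p q :
  combination Q P p -> combination Q P q -> combination Q P (p + q).
Proof.
by elim=> [|s u p' Qs Pu _ IH] Hq; rewrite ?add0r // -addrA; constructor; auto.
Qed.

Lemma combination_gen Q P s u : Q s -> P u -> combination Q P (s * u).
Proof. by move=> *; rewrite -[_ * _]addr0; do 2?constructor. Qed.

Lemma combination_sum Q P (I : Type) (r : seq I) (A : pred I) (F : I -> T) :
    (forall i, A i -> combination Q P (F i)) ->
  combination Q P (\sum_(i <- r | A i) F i).
Proof.
move=> HF; apply: big_ind => //; first exact: combination0.
exact: combination_add.
Qed.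

Lemma combination_mull Q Q' P c p : (forall s, Q s -> Q' (c * s)) ->
  combination Q P p -> combination Q' P (c * p).
Proof.
move=> QQ'; elim=> [|s u p' Qs Pu _ IH]; first by rewrite mulr0; constructor.
by rewrite mulrDr mulrA; constructor; auto.
Qed.

Lemma ideal0 P : ideal P 0. Proof. exact: combination0. Qed.

Lemma idealD P p q : ideal P p -> ideal P q -> ideal P (p + q).
Proof. exact: combination_add. Qed.

Lemma idealM P c p : ideal P p -> ideal P (c * p).
Proof. exact: combination_mull. Qed.

Lemma idealMr P c p : ideal P p -> ideal P (p * c).
Proof. by rewrite mulrC; apply: idealM. Qed.

Lemma idealN P p : ideal P p -> ideal P (- p).
Proof. by rewrite -mulN1r; apply: idealM. Qed.

Lemma idealB P p q : ideal P p -> ideal P q -> ideal P (p - q).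
Proof. by move=> Hp Hq; apply/idealD/idealN. Qed.

Lemma ideal_gen P u : P u -> ideal P u.
Proof. by move=> Pu; rewrite -[u]mul1r; apply: combination_gen. Qed.

Lemma ideal_sum P (I : Type) (r : seq I) (A : pred I) (F : I -> T) :
  (forall i, A i -> ideal P (F i)) -> ideal P (\sum_(i <- r | A i) F i).
Proof. exact: combination_sum. Qed.

Lemma ideal_mono P P' p : (forall u, P u -> ideal P' u) ->
  ideal P p -> ideal P' p.
Proof.
move=> PP'; elim=> [|s u p' _ Pu _ IH]; first exact: ideal0.
by apply/idealD => //; apply/idealM/PP'.
Qed.

Lemma ideal_prin a p : ideal (eq a) p <-> exists t, p = a * t.
Proof.
split=> [|[t ->]]; last exact/idealMr/ideal_gen.
elim=> [|s u p' _ <- _ [t ->]]; first by exists 0; rewrite mulr0.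
by exists (s + t); rewrite mulrDr [s * a]mulrC.
Qed.

End Combinations.

Section Polynomials.
Variables (C : fieldType) (n : nat).
Local Notation S := {mpoly C[n]}.
Implicit Types (p q : S).

Lemma mpoly_alg_ind (P : S -> Prop) :
    (forall c, P c%:MP) -> (forall i, P 'X_i) ->
    (forall p q, P p -> P q -> P (p + q)) ->
    (forall p q, P p -> P q -> P (p * q)) ->
  forall p, P p.
Proof.
move=> PC PX PD PM p; elim/mpolyind: p => [|c m p _ _ Pp].
  by rewrite -mpolyC0.
apply: PD => //; rewrite -mul_mpolyC mpolyXE_id; apply: (PM) => //.
elim/big_rec: _ => [|i q _ Pq]; first by rewrite -mpolyC1.
apply: (PM) Pq; elim: (m i) => [|k IH]; first by rewrite expr0 -mpolyC1.
by rewrite exprS; apply: PM.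
Qed.

Lemma mpoly_rmorph_eq (T : nzRingType) (f g : {rmorphism S -> T}) :
    (forall c, f c%:MP = g c%:MP) -> (forall i, f 'X_i = g 'X_i) ->
  f =1 g.
Proof.
move=> eC eX; apply: mpoly_alg_ind => // p q ep eq.
  by rewrite !rmorphD ep eq.
by rewrite !rmorphM ep eq.
Qed.

Lemma comp_mpolyXi k (h : n.-tuple {mpoly C[k]}) i : 'X_i \mPo h = tnth h i.
Proof. by rewrite comp_mpolyXU -tnth_nth. Qed.

Lemma comp_mpoly_congr k (P : {mpoly C[k]} -> Prop) (h h' : n.-tuple {mpoly C[k]}) p :
  (forall i, ideal P (tnth h i - tnth h' i)) -> ideal P ((p \mPo h) - (p \mPo h')).
Proof.
move=> Hh; elim/mpoly_alg_ind: p => [c|i|p q Hp Hq|p q Hp Hq].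
- by rewrite !comp_mpolyC subrr; apply: ideal0.
- by rewrite !comp_mpolyXi.
- by rewrite !comp_mpolyD opprD addrACA; apply: idealD.
rewrite !rmorphM /=.
rewrite (_ : _ - _ = ((p \mPo h) - (p \mPo h')) * (q \mPo h) +
                     (p \mPo h') * ((q \mPo h) - (q \mPo h'))).
  by apply: idealD; [apply: idealMr | apply: idealM].
by rewrite mulrBl mulrBr addrA subrK.
Qed.

Lemma comp_mpoly0E p : p \mPo [tuple 0 | i < n] = (p@_0)%:MP :> S.
Proof.
elim/mpoly_alg_ind: p => [c|i|p q Hp Hq|p q Hp Hq].
- by rewrite comp_mpolyC mcoeffC eqxx mulr1.
- by rewrite comp_mpolyXi tnth_mktuple mcoeffX mnm1_eq0 mpolyC0.
- by rewrite comp_mpolyD Hp Hq mcoeffD mpolyCD.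
- by rewrite rmorphM /= Hp Hq [(p * q)@_0]rmorphM mpolyCM.
Qed.

Lemma dhomog0_const p : p \is 0.-homog -> p = (p@_0)%:MP.
Proof.
move=> hp; apply/mpolyP => m; rewrite mcoeffC.
have [->|nz] := eqVneq m 0%MM; first by rewrite mulr1.
by rewrite mulr0; apply: (dhomog_nemf_coeff hp); rewrite /= mdeg_eq0.
Qed.

Definition on_line (v : 'rV[C]_n) : S -> {poly C} :=
  mmap (@polyC C) (fun i => v 0 i *: 'X).

HB.instance Definition _ v := GRing.RMorphism.copy (on_line v) (on_line v).

Lemma on_lineC v c : on_line v c%:MP = c%:P.
Proof. by rewrite /on_line mmapC. Qed.

Lemma on_lineZ v c p : on_line v (c *: p) = c *: on_line v p.
Proof. by rewrite /on_line mmapZ mul_polyC. Qed.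

Lemma on_lineX v i : on_line v 'X_i = v 0 i *: 'X.
Proof. by rewrite /on_line mmapX mmap1U. Qed.

Lemma on_line_homog v p d : p \is d.-homog -> on_line v p = p.@[v 0] *: 'X^d.
Proof.
move=> hp; rewrite {1}(mpolyE p) rmorph_sum mevalE scaler_suml /=.
rewrite big_seq [RHS]big_seq; apply: eq_bigr => m mp; rewrite on_lineZ -scalerA.
congr (_ *: _); rewrite -(dhomog_mf hp mp) /= mdegE.
rewrite /on_line mmapX /mmap1 (eq_bigr (fun i => v 0 i ^+ m i *: 'X^(m i))).
  by rewrite scaler_prod prodrXr.
by move=> i _; rewrite exprZn.
Qed.

Lemma meval_homog_scale v a p d :
  p \is d.-homog -> p.@[(a *: v : 'rV_n) 0] = a ^+ d * p.@[v 0].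
Proof.
move=> hp; rewrite !mevalE mulr_sumr big_seq [RHS]big_seq.
apply: eq_bigr => m mp; rewrite mulrCA; congr (_ * _).
rewrite -(dhomog_mf hp mp) /= mdegE -prodrXr -big_split /=.
by apply: eq_bigr => i _; rewrite mxE exprMn.
Qed.

Lemma on_line_coef v p k : (on_line v p)`_k = (pihomog mdeg k p).@[v 0].
Proof.
rewrite {1}(pihomog_partitionE (leqnSn (msize p))) rmorph_sum coef_sum /=.
under eq_bigr => i _ do rewrite (on_line_homog v (pihomogP _ i p)) coefZ coefXn.
have [lt_k|le_k] := ltnP k (msize p).+1.
  rewrite (bigD1 (Ordinal lt_k)) //= eqxx mulr1 big1 ?addr0 // => i ne_i.
  by rewrite eq_sym (_ : _ == _ = false) ?mulr0 //; apply/negbTE.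
rewrite big1 => [|i _]; last first.
  by rewrite gtn_eqF ?mulr0 // (leq_trans (ltn_ord i)).
rewrite pihomogE big_seq_cond big1 ?meval0 // => m /andP[mp /eqP E].
by have := msize_mdeg_lt mp; rewrite E ltnNge (ltnW le_k).
Qed.

Lemma on_line_const v p : (on_line v p)`_0 = p@_0.
Proof.
elim/mpoly_alg_ind: p => [c|i|p q Hp Hq|p q Hp Hq].
- by rewrite on_lineC coefC eqxx mcoeffC eqxx mulr1.
- by rewrite on_lineX coefZ coefX mulr0 mcoeffX mnm1_eq0.
- by rewrite rmorphD coefD /= Hp Hq mcoeffD.
by rewrite rmorphM /= coef0M Hp Hq [RHS]rmorphM.
Qed.

Lemma mderiv_homog p d i : p \is d.-homog -> p^`M(i) \is d.-1.-homog.
Proof.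
move=> hp; rewrite (mpolyE p) raddf_sum big_seq; apply: rpred_sum => m mp /=.
rewrite mderivZ mderivX; apply: rpredZ.
have [->|nz] := eqVneq (m i) 0%N; first by rewrite scale0r rpred0.
apply: rpredZ; rewrite dhomogX /= -(dhomog_mf hp mp) /= -(@submK _ U_(i) m) ?lep1mP //.
by rewrite addmK mdegD mdeg1 addn1.
Qed.

Lemma cV_neq0 (c : 'cV[C]_n) : c != 0 -> exists j, c j 0 != 0.
Proof.
move=> nz; apply/existsP; apply: contraNT nz => /existsPn c0.
by apply/eqP/matrixP => j k; rewrite ord1 mxE; apply/eqP/negPn/c0.
Qed.

(** A linear form is given by the column vector of its coefficients. *)
Definition linform (c : 'cV[C]_n) : S := \sum_j c j 0 *: 'X_j.

Lemma linform_eval c (v : 'rV[C]_n) : (linform c).@[v 0] = (v *m c) 0 0.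
Proof.
rewrite /linform raddf_sum mxE; apply: eq_bigr => j _ /=.
by rewrite mevalZ mevalXU mulrC.
Qed.

Lemma linformZ (a : C) c : linform (a *: c) = a *: linform c.
Proof.
by rewrite /linform scaler_sumr; apply: eq_bigr => j _; rewrite mxE scalerA.
Qed.

Lemma linformD c c' : linform (c + c') = linform c + linform c'.
Proof.
by rewrite /linform -big_split; apply: eq_bigr => j _; rewrite mxE scalerDl.
Qed.

Lemma linform_col1 i : linform (col i 1%:M) = 'X_i.
Proof.
rewrite /linform (bigD1 i) //= !mxE eqxx scale1r big1 ?addr0 // => j /negPf ne.
by rewrite !mxE ne scale0r.
Qed.

Lemma linform_coef c j : (linform c)@_(U_(j)) = c j 0.
Proof.
rewrite /linform raddf_sum (bigD1 j) //= mcoeffZ mcoeffXU eqxx mulr1.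
rewrite big1 ?addr0 // => i ne_ij; rewrite mcoeffZ mcoeffXU.
by rewrite (negPf ne_ij) mulr0.
Qed.

Lemma linform_eq0 c : (linform c == 0) = (c == 0).
Proof.
apply/eqP/eqP => [c0|->]; last first.
  by rewrite /linform big1 // => j _; rewrite mxE scale0r.
by apply/matrixP => j k; rewrite ord1 -linform_coef c0 mcoeff0 mxE.
Qed.

Lemma linform_msize c : c != 0 -> msize (linform c) = 2.
Proof.
move=> nz; apply/eqP; rewrite eqn_leq; apply/andP; split.
  apply: leq_trans (msize_sum _ _ _) _; apply/bigmax_leqP => i _.
  by apply: leq_trans (msizeZ_le _ _) _; rewrite msizeX mdeg1.
have [j nzj] := cV_neq0 nz.
have := msize_mdeg_lt (p := linform c) (m := U_(j)).
by rewrite mdeg1; apply; rewrite mcoeff_msupp linform_coef.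
Qed.

(** The substitution that projects onto the kernel of the form is a ring
    morphism to a domain, and its kernel is the ideal of the form. *)
Lemma linform_prime c p q t : c != 0 ->
    p * q = linform c * t ->
  (exists p', p = linform c * p') \/ (exists q', q = linform c * q').
Proof.
move=> nz; set a := linform c => Epq.
have [j nzj] := cV_neq0 nz.
pose h := [tuple 'X_i - (i == j)%:R *: ((c j 0)^-1 *: a) | i < n].
have mod_a r : ideal (eq a) (r - (r \mPo h)).
  rewrite -{1}[r]comp_mpoly_id; apply: comp_mpoly_congr => i.
  rewrite !tnth_mktuple opprB addrC subrK; apply/ideal_prin.
  by exists (((i == j)%:R * (c j 0)^-1)%:MP); rewrite [RHS]mulrC mul_mpolyC scalerA.
have a0 : a \mPo h = 0.
  rewrite {1}/a /linform raddf_sum /=.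
  rewrite (eq_bigr (fun i => c i 0 *: 'X_i - ((i == j)%:R * (c i 0 / c j 0)) *: a)).
    rewrite sumrB (_ : \sum_i c i 0 *: 'X_i = a) // (bigD1 j) //= eqxx mul1r.
    rewrite divff // scale1r big1 ?addr0 ?subrr //.
    by move=> i /negPf ->; rewrite mul0r scale0r.
  move=> i _; rewrite comp_mpolyZ comp_mpolyXi tnth_mktuple scalerBr !scalerA.
  by rewrite mulrCA mulrA.
have dvd r : r \mPo h = 0 -> exists r', r = a * r'.
  by move=> r0; apply/ideal_prin; rewrite -[r]subr0 -r0.
have /eqP : (p \mPo h) * (q \mPo h) = 0 by rewrite -rmorphM /= Epq rmorphM /= a0 mul0r.
by rewrite mulf_eq0 => /orP[] /eqP /dvd; [left | right].
Qed.

Lemma comp_linform_msize (h : n.-tuple S) p :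
  (forall i, (msize (tnth h i) <= 2)%N) -> (msize (p \mPo h) <= msize p)%N.
Proof.
move=> Hh; rewrite comp_mpolyE.
apply: leq_trans (msize_sum _ _ _) _; apply/bigmax_leqP_seq => m mp _.
apply: leq_trans (msizeZ_le _ _) _; apply: leq_trans (msize_mdeg_lt mp).
have prodle (r1 r2 : S) k1 k2 : (msize r1 <= k1.+1 -> msize r2 <= k2.+1 ->
    msize (r1 * r2) <= (k1 + k2).+1)%N.
  move=> H1 H2; have [->|nz1] := eqVneq r1 0; first by rewrite mul0r msize0.
  have [->|nz2] := eqVneq r2 0; first by rewrite mulr0 msize0.
  by rewrite msizeM //; move: (msize r1) (msize r2) H1 H2 => a b; lia.
rewrite mdegE; elim/big_rec2: _ => [|i y1 y2 _ Hy]; first by rewrite msize1.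
apply: (prodle) => //; elim: (m i) => [|e IH]; first by rewrite expr0 msize1.
by rewrite exprS; apply: (prodle _ _ 1%N e).
Qed.

Lemma mderiv_comp k (h : n.-tuple {mpoly C[k]}) p i :
  (p \mPo h)^`M(i) = \sum_j (p^`M(j) \mPo h) * (tnth h j)^`M(i).
Proof.
elim/mpoly_alg_ind: p => [c|l|p q Hp Hq|p q Hp Hq].
- rewrite comp_mpolyC mderivC big1 // => j _.
  by rewrite mderivC comp_mpoly0 mul0r.
- rewrite comp_mpolyXi (bigD1 l) //= big1 => [|j ne_jl].
    rewrite addr0 mderivX mnm1E eqxx scale1r -{1}[U_(l)%MM]addm0 addmC addmK.
    by rewrite mpolyX0 comp_mpoly1 mul1r.
  rewrite mderivX mnm1E eq_sym (negPf ne_jl) scale0r.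
  by rewrite comp_mpoly0 mul0r.
- rewrite comp_mpolyD mderivD Hp Hq -big_split /=; apply: eq_bigr => j _.
  by rewrite mderivD comp_mpolyD mulrDl.
rewrite rmorphM /= mderivM Hp Hq mulr_suml mulr_sumr -big_split /=.
apply: eq_bigr => j _; rewrite mderivM comp_mpolyD !rmorphM /= mulrDl.
by rewrite mulrAC mulrA.
Qed.

Lemma mpoly_euler p d : p \is d.-homog -> \sum_j 'X_j * p^`M(j) = d%:R *: p.
Proof.
move=> hp; rewrite [in RHS](mpolyE p) scaler_sumr [in LHS](mpolyE p).
under eq_bigr do rewrite raddf_sum /= mulr_sumr.
rewrite exchange_big /=; rewrite big_seq [RHS]big_seq; apply: eq_bigr => m mp.
rewrite -(dhomog_mf hp mp) /= mdegE natr_sum scaler_suml.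
apply: eq_bigr => j _; rewrite mderivZ mderivX.
have [m0|m0] := eqVneq (m j) 0%N; first by rewrite m0 !scale0r scaler0 mulr0.
by rewrite -!scalerAr -mpolyXD addmC submK ?lep1mP // !scalerA mulrC.
Qed.

End Polynomials.

(** * The determinant that generates the socle *)

Section Socle.
Variables (C : fieldType) (n : nat).
Local Notation S := {mpoly C[n]}.
Implicit Types (p q : S).

Lemma ideal_mulmono (P P' : S -> Prop) c p :
  (forall u, P u -> ideal P' (c * u)) -> ideal P p -> ideal P' (c * p).
Proof.
move=> PP'; elim=> [|s u p' _ Pu _ IH]; first by rewrite mulr0; apply: ideal0.
by rewrite mulrDr mulrCA; apply/idealD => //; apply/idealM/PP'.
Qed.

Lemma mcoeffMX_eq0 p (a m : 'X_{1..n}) : ~~ (a <= m)%MM -> (p * 'X_[a])@_m = 0.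
Proof.
move=> nle; rewrite (mpolyE p) mulr_suml raddf_sum big1 // => u _ /=.
rewrite -scalerAl -mpolyXD mcoeffZ mcoeffX.
case: eqP => [eq_m|]; last by rewrite mulr0.
by case/negP: nle; rewrite -eq_m; apply/mnm_lepP => i; rewrite mnmDE leq_addl.
Qed.

Lemma ideal_mcoeff_eq0 (P : S -> Prop) p m :
    (forall u, P u -> exists2 a : 'X_{1..n}, u = 'X_[a] & ~~ (a <= m)%MM) ->
  ideal P p -> p@_m = 0.
Proof.
move=> HP; elim=> [|s u q _ /HP[a -> nle] _ IH]; first by rewrite mcoeff0.
by rewrite mcoeffD IH addr0 mcoeffMX_eq0.
Qed.

(** The identity [Q x = (x_i ^ N)] is only required modulo the variables of index
    at least [k], and this is what makes the induction work.

    Multiplying the determinant by the last variable replaces the last column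
    of [Q] by [Q x], that is by the column of the [N]-th powers.  Only the last
    of these powers can contribute to the coefficient, and what it multiplies
    is the leading minor of size [k]. *)
Lemma mcoeff_det_pow N k (le_kn : (k <= n)%N) (Q : 'M[S]_k) : (0 < N)%N ->
    (forall i, ideal (fun u => exists2 l : 'I_n, (k <= l)%N & u = 'X_l)
       (\sum_j Q i j * 'X_(widen_ord le_kn j) - 'X_(widen_ord le_kn i) ^+ N)) ->
  (\det Q)@_[multinom ((i < k)%N * N.-1)%N | i < n] = 1.
Proof.
move=> N_gt0; elim: k => [|k IHk] in le_kn Q *.
  move=> _; rewrite det_mx00 mcoeff1.
  by case: eqP => // -[]; apply/mnmP => i; rewrite mnmE mnm0E.
move=> HQ; set m := (X in (_@_X)).
pose w j : 'I_n := widen_ord le_kn j; pose z : 'I_n := w ord_max.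
pose e i := \sum_j Q i j * 'X_(w j) - 'X_(w i) ^+ N.
have dup : \det Q * 'X_z =
    \sum_i \adj Q ord_max i * 'X_(w i) ^+ N + \sum_i \adj Q ord_max i * e i.
  rewrite -big_split /=; under [RHS]eq_bigr do rewrite -mulrDr addrC subrK.
  transitivity ((\adj Q *m (Q *m \col_j 'X_(w j))) ord_max 0 : S); last first.
    rewrite mxE; apply: eq_bigr => i _; congr (_ * _); rewrite mxE.
    by apply: eq_bigr => j _; rewrite mxE.
  by rewrite mulmxA mul_adj_mx mul_scalar_mx !mxE.
rewrite -(mcoeffMX _ U_(z)) dup mcoeffD.
rewrite (ideal_mcoeff_eq0 (P := fun u => exists2 l : 'I_n, (k < l)%N & u = 'X_l)
  (p := \sum_i \adj Q ord_max i * e i)).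
- rewrite addr0 big_ord_recr /= mcoeffD raddf_sum big1 /= => [|i _].
    have le_kn' : (k <= n)%N by apply: ltnW.
    have Ez : (U_(z) + m = U_(z) *+ N + [multinom ((i < k)%N * N.-1)%N | i < n])%MM.
      apply/mnmP => i; rewrite !mnmDE mulmnE mnm1E !mnmE.
      have -> : (z == i) = (val i == k) by rewrite eq_sym.
      by rewrite ltnS; case: (ltngtP i k) => //=; lia.
    rewrite add0r mpolyXn Ez mcoeffMX !mxE /cofactor -signr_odd addnn odd_double.
    rewrite expr0 mul1r; apply: (IHk le_kn') => i.
    rewrite (_ : _ - _ = e (widen_ord (leqnSn k) i) -
       Q (widen_ord (leqnSn k) i) ord_max * 'X_z).
      apply: idealB; last by apply/idealM/ideal_gen; exists z.
      apply: ideal_mono (HQ _) => u [l lt_kl ->].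
      by apply: ideal_gen; exists l => //; apply: ltnW.
    rewrite /e big_ord_recr /= addrAC addrK; congr (_ - _).
      apply: eq_bigr => j _; rewrite !mxE; congr (Q _ _ * 'X_ _); apply: val_inj => //=.
      - by rewrite /bump leqNgt ltn_ord add0n.
      - by rewrite /bump leqNgt ltn_ord add0n.
  rewrite mpolyXn mcoeffMX_eq0 //.
  apply/negP => /mnm_lepP /(_ (w (widen_ord (leqnSn k) i))).
  rewrite mnmDE mulmnE !mnm1E eqxx !mnmE /= (_ : z == _ = false).
    by have := ltn_ord i; lia.
  by apply/negbTE/eqP => /(congr1 val) /= Ek; have := ltn_ord i; rewrite -Ek ltnn.
- move=> u [l lt_kl ->]; exists U_(l)%MM => //; apply/negP => /mnm_lepP /(_ l).
  rewrite mnmDE !mnm1E eqxx mnmE (_ : (l < k.+1)%N = false); last by lia.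
  by case: eqP => // E; rewrite -E /= ltnn in lt_kl.
by apply: ideal_sum => i _; apply/idealM/HQ.
Qed.

(** If [det M] were a combination of the [f j], then [det D * det M] would lie in
    the ideal of the [N]-th powers, which contradicts [mcoeff_det_pow]. *)
Lemma det_notin_ideal N (f : 'cV[S]_n) (M D : 'M[S]_n) : (0 < N)%N ->
    f = M *m (\col_i 'X_i) -> D *m f = \col_i ('X_i ^+ N) ->
  ~ ideal (fun u => exists i, u = f i 0) (\det M).
Proof.
move=> N_gt0 fE DE Hdet.
pose m := [multinom ((i < n)%N * N.-1)%N | i < n].
have det1 : (\det (D *m M))@_m = 1.
  apply: (@mcoeff_det_pow N n (leqnn n)) => // i.
  rewrite (_ : _ - _ = 0); first exact: ideal0.
  apply/eqP; rewrite subr_eq0; apply/eqP.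
  transitivity ((D *m M *m \col_j 'X_j) i 0 : S).
    rewrite [RHS]mxE; apply: eq_bigr => j _; congr (_ * _); rewrite mxE.
    by congr ('X_ _); apply: val_inj.
  by rewrite -mulmxA -fE DE mxE; congr ('X_ _ ^+ _); apply: val_inj.
have Hpow : ideal (fun u : S => exists i : 'I_n, u = 'X_i ^+ N) (\det D * \det M).
  apply: ideal_mulmono Hdet => _ [i ->].
  have -> : \det D * f i 0 = (\adj D *m (D *m f)) i 0.
    by rewrite mulmxA mul_adj_mx mul_scalar_mx mxE.
  rewrite DE mxE; apply: ideal_sum => j _; apply/idealM/ideal_gen.
  by exists j; rewrite mxE.
move/eqP: det1; rewrite det_mulmx (ideal_mcoeff_eq0 _ Hpow) 1?eq_sym ?oner_eq0 //.
move=> _ [i ->]; exists (U_(i) *+ N)%MM; first by rewrite mpolyXn.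
apply/negP => /mnm_lepP /(_ i); rewrite mulmnE mnm1E eqxx mnmE ltn_ord /=.
by lia.
Qed.

End Socle.

(** * Invariants and the Hilbert ideal of a group generated by reflections *)

Section Invariants.
Variables (C : numFieldType) (gT : finGroupType) (G : {group gT}) (n : nat).
Variable rG : mx_representation C G n.
Local Notation S := {mpoly C[n]}.
Local Notation act := (mpoly_act rG).
Local Notation invariant := (mpoly_invariant rG).
Implicit Types (p q s u : S) (g h r : gT) (v : 'rV[C]_n) (c : 'cV[C]_n).

Lemma mpoly_actD g : {morph act g : p q / p + q}.
Proof. exact: rmorphD. Qed.

Lemma mpoly_actB g : {morph act g : p q / p - q}.
Proof. exact: rmorphB. Qed.

Lemma mpoly_actM g : {morph act g : p q / p * q}.
Proof. exact: rmorphM. Qed.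

Lemma mpoly_actZ g a : {morph act g : p / a *: p}.
Proof. by move=> p; rewrite /mpoly_act comp_mpolyZ. Qed.

Lemma mpoly_act0 g : act g 0 = 0.
Proof. exact: rmorph0. Qed.

Lemma mpoly_act_sum g (I : Type) (rr : seq I) (P : pred I) (F : I -> S) :
  act g (\sum_(i <- rr | P i) F i) = \sum_(i <- rr | P i) act g (F i).
Proof. exact: rmorph_sum. Qed.

Lemma mpoly_act_linform g c : act g (linform c) = linform (rG g *m c).
Proof.
rewrite /linform mpoly_act_sum.
under eq_bigr => i _ do
  rewrite mpoly_actZ /mpoly_act comp_mpolyXi tnth_mktuple scaler_sumr.
rewrite exchange_big; apply: eq_bigr => j _ /=.
by rewrite mxE scaler_suml; apply: eq_bigr => i _; rewrite scalerA mulrC.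
Qed.

Lemma mpoly_actX g i : act g 'X_i = linform (col i (rG g)).
Proof.
rewrite /mpoly_act comp_mpolyXi tnth_mktuple.
by apply: eq_bigr => j _; rewrite mxE.
Qed.

Lemma mpoly_act_eval g p v : (act g p).@[v 0] = p.@[(v *m rG g) 0].
Proof.
rewrite comp_mpoly_meval; apply: meval_eq => i; rewrite tnth_mktuple.
rewrite raddf_sum mxE; apply: eq_bigr => j _ /=.
by rewrite mevalZ mevalXU mulrC.
Qed.

Lemma mcoeff0_eval p : p@_0 = p.@[(0 : 'rV_n) 0].
Proof.
have /= -> // := mpoly_rmorph_eq (f := mcoeff 0%MM) (g := meval ((0 : 'rV[C]_n) 0)).
  by move=> c /=; rewrite mevalC mcoeffC eqxx mulr1.
by move=> i /=; rewrite mevalXU mxE mcoeffX mnm1_eq0.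
Qed.

Lemma mpoly_act_const g p : (act g p)@_0 = p@_0.
Proof. by rewrite !mcoeff0_eval mpoly_act_eval mul0mx. Qed.

Lemma mpoly_act_id p : act 1%g p = p.
Proof.
rewrite -[RHS]comp_mpoly_id; congr (_ \mPo _); apply: eq_mktuple => i.
rewrite repr_mx1 -[RHS]linform_col1 /linform; apply: eq_bigr => j _.
by rewrite !mxE.
Qed.

Lemma mpoly_act_mul g h p : g \in G -> h \in G -> act (g * h)%g p = act g (act h p).
Proof.
move=> Gg Gh; move: p; apply: mpoly_alg_ind => [a|i|p q Hp Hq|p q Hp Hq].
- by rewrite /mpoly_act !comp_mpolyC.
- rewrite !mpoly_actX mpoly_act_linform; congr linform.
  by rewrite repr_mxM // colE -mulmxA -colE.
- by rewrite !mpoly_actD Hp Hq.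
- by rewrite !mpoly_actM Hp Hq.
Qed.

Lemma mpoly_actK g p : g \in G -> act g^-1 (act g p) = p.
Proof. by move=> Gg; rewrite -mpoly_act_mul ?groupV // mulVg mpoly_act_id. Qed.

Lemma mpoly_act_eq0 g p : g \in G -> (act g p == 0) = (p == 0).
Proof.
move=> Gg; apply/eqP/eqP => [p0|->]; last exact: mpoly_act0.
by rewrite -(mpoly_actK p Gg) p0 mpoly_act0.
Qed.

Lemma mpoly_act_msize g p : (msize (act g p) <= msize p)%N.
Proof.
apply: comp_linform_msize => i; rewrite tnth_mktuple.
apply: leq_trans (msize_sum _ _ _) _; apply/bigmax_leqP => j _.
by apply: leq_trans (msizeZ_le _ _) _; rewrite msizeX mdeg1.
Qed.

Lemma mpoly_act_homog g p d : p \is d.-homog -> act g p \is d.-homog.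
Proof.
move=> hp; rewrite /mpoly_act comp_mpolyE big_seq; apply: rpred_sum => m mp.
apply: rpredZ; rewrite -(dhomog_mf hp mp) /= mdegE.
elim/big_rec2: _ => [|i y1 y2 _ Hy]; first exact: dhomog1.
apply: dhomogM => //; rewrite tnth_mktuple -[X in X.-homog]mul1n.
apply: dhomogMn; apply: rpred_sum => j _; apply: rpredZ.
by rewrite dhomogX /= mdeg1.
Qed.

Lemma mpoly_act_pihomog g p d :
  act g (pihomog mdeg d p) = pihomog mdeg d (act g p).
Proof.
have -> : act g p = \sum_(i < msize p) act g (pihomog mdeg i p).
  by rewrite -mpoly_act_sum -pihomog_partitionE.
rewrite raddf_sum /=.
have other (i : nat) : i != d -> pihomog mdeg d (act g (pihomog mdeg i p)) = 0.
  by move=> ne; apply: (pihomog_ne0 ne); apply/mpoly_act_homog/pihomogP.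
have same : pihomog mdeg d (act g (pihomog mdeg d p)) = act g (pihomog mdeg d p).
  by apply/pihomog_dE/mpoly_act_homog/pihomogP.
have [lt_d|le_d] := ltnP d (msize p).
  rewrite (bigD1 (Ordinal lt_d)) //= same big1 ?addr0 // => i ne_i.
  by apply: other; apply: contraNneq ne_i => E; apply/eqP/val_inj.
rewrite big1 => [|i _]; last by apply: other; rewrite neq_ltn (leq_trans _ le_d).
rewrite pihomogE big_seq_cond big1 ?mpoly_act0 // => m /andP[mp /eqP E].
by have := msize_mdeg_lt mp; rewrite E ltnNge le_d.
Qed.

Lemma invariantC a : invariant a%:MP.
Proof. by move=> g _; rewrite /mpoly_act comp_mpolyC. Qed.

Lemma invariantD p q : invariant p -> invariant q -> invariant (p + q).
Proof. by move=> Ip Iq g Gg; rewrite mpoly_actD Ip ?Iq. Qed.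

Lemma invariantM p q : invariant p -> invariant q -> invariant (p * q).
Proof. by move=> Ip Iq g Gg; rewrite mpoly_actM Ip ?Iq. Qed.

Lemma invariantZ a p : invariant p -> invariant (a *: p).
Proof. by move=> Ip g Gg; rewrite mpoly_actZ Ip. Qed.

Lemma invariantB p q : invariant p -> invariant q -> invariant (p - q).
Proof. by move=> Ip Iq g Gg; rewrite mpoly_actB Ip ?Iq. Qed.

Lemma invariant_sum (I : Type) (rr : seq I) (P : pred I) (F : I -> S) :
    (forall i, P i -> invariant (F i)) ->
  invariant (\sum_(i <- rr | P i) F i).
Proof.
by move=> IF g Gg; rewrite mpoly_act_sum; apply: eq_bigr => i Pi; apply: IF.
Qed.

Lemma invariant_pihomog p d : invariant p -> invariant (pihomog mdeg d p).
Proof. by move=> Ip g Gg; rewrite mpoly_act_pihomog Ip. Qed.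

Lemma invariant_eval p v g :
  invariant p -> g \in G -> p.@[(v *m rG g) 0] = p.@[v 0].
Proof. by move=> Ip Gg; rewrite -mpoly_act_eval Ip. Qed.

Definition pos_invariant p := invariant p /\ p@_0 = 0.

Definition hilbert_ideal : S -> Prop := ideal pos_invariant.

Lemma hilbert_ideal_act g p : g \in G -> hilbert_ideal p -> hilbert_ideal (act g p).
Proof.
move=> Gg; elim=> [|s u q _ [Iu u0] _ IH]; first by rewrite mpoly_act0; apply: ideal0.
rewrite mpoly_actD mpoly_actM Iu //.
by apply: idealD => //; apply/idealM/ideal_gen.
Qed.

Definition orbit_sum p := \sum_(g in G) act g p.

Lemma orbit_sum_invariant p : invariant (orbit_sum p).
Proof.
move=> g Gg; rewrite mpoly_act_sum.
rewrite [RHS](reindex_inj (mulgI g)) /=; apply: eq_big => h.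
  by rewrite groupMl.
by move=> Gh; rewrite mpoly_act_mul.
Qed.

Lemma orbit_sumD p q : orbit_sum (p + q) = orbit_sum p + orbit_sum q.
Proof. by rewrite -big_split; apply: eq_bigr => g _; rewrite mpoly_actD. Qed.

Lemma orbit_sum0 : orbit_sum 0 = 0.
Proof. by apply: big1 => g _; rewrite mpoly_act0. Qed.

Lemma orbit_sumM p u : invariant u -> orbit_sum (p * u) = orbit_sum p * u.
Proof.
by move=> Iu; rewrite mulr_suml; apply: eq_bigr => g Gg; rewrite mpoly_actM Iu.
Qed.

Lemma orbit_sum_id u : invariant u -> orbit_sum u = #|G|%:R *: u.
Proof.
by move=> Iu; rewrite /orbit_sum (eq_bigr (fun=> u)) // sumr_const scaler_nat.
Qed.

Lemma orbit_sum_const p : (orbit_sum p)@_0 = #|G|%:R * p@_0.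
Proof.
rewrite raddf_sum (eq_bigr (fun=> p@_0)) => [|g _]; last exact: mpoly_act_const.
by rewrite sumr_const mulr_natl.
Qed.

Lemma card_neq0 : #|G|%:R != 0 :> C.
Proof. by rewrite pnatr_eq0 -lt0n cardG_gt0. Qed.

Lemma orbit_sum_combination (Q P : S -> Prop) p : (forall u, P u -> invariant u) ->
    combination Q P p ->
  combination (fun s => exists2 t, Q t & s = orbit_sum t) P (orbit_sum p).
Proof.
move=> PI; elim=> [|s u q Qs Pu _ IH]; first by rewrite orbit_sum0; constructor.
rewrite orbit_sumD orbit_sumM; last exact: PI.
by constructor => //; exists s.
Qed.

(** The root form of the reflection [r] is [linform c]: it vanishes on the
    hyperplane of [r]. *)
Definition root_of r c := c != 0 /\ exists2 u : 'rV_n, u != 0 & rG r = 1%:M + c *m u.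

Lemma root_of_act_sub r c p : root_of r c -> exists t, act r p - p = linform c * t.
Proof.
case=> nz [u _ rE]; apply/ideal_prin; rewrite -{2}[p]comp_mpoly_id.
apply: comp_mpoly_congr => i; rewrite -comp_mpolyXi -[_ \mPo _]/(act r _) mpoly_actX.
rewrite tnth_mktuple -linform_col1 (_ : col i (rG r) = col i 1%:M + u 0 i *: c).
  rewrite linformD addrC addKr linformZ -mul_mpolyC.
  by apply/ideal_prin; exists (u 0 i)%:MP; rewrite mulrC.
by apply/matrixP => j l; rewrite rE ord1 !mxE big_ord1 [c j 0 * _]mulrC.
Qed.

Lemma gen_subset_ind (Y : {set gT}) (P : gT -> Prop) :
    <<Y>>%g = G -> P 1%g ->
    (forall g h, g \in G -> h \in G -> P g -> P h -> P (g * h)%g) ->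
    (forall r, r \in Y -> P r) ->
  forall g, g \in G -> P g.
Proof.
move=> genY P1 PM PY; pose K := [set g in G | `[< P g >]].
have gK : group_set K.
  apply/group_setP; split=> [|g h]; first by rewrite inE group1; apply/asboolP.
  rewrite !inE => /andP[Gg /asboolP Pg] /andP[Gh /asboolP Ph].
  by rewrite groupM //; apply/asboolP/PM.
have /subsetP sGK : G \subset Group gK.
  rewrite -genY gen_subG; apply/subsetP => r Yr; rewrite /= inE -genY mem_gen //.
  by apply/asboolP/PY.
by move=> g /sGK; rewrite /= inE => /andP[_ /asboolP].
Qed.

Variable X : {set gT}.
Hypothesis genX : <<X>>%g = G.
Hypothesis rootX : forall r, r \in X -> exists c, root_of r c.

Lemma sub_genX : X \subset G.
Proof. by rewrite -genX subset_gen. Qed.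

(** The last hypothesis says that no multiple of [u ord0] by an invariant with
    nonzero constant term is a combination of the other [u i] with invariant
    coefficients.

    Induction on the degree of [s ord0]: dividing [act r (s i) - s i] by the root
    form of a reflection [r] gives another relation between the [u i], of lower
    degree.  So [s ord0] is congruent to its average, which has no constant term
    because the averaged relation has invariant coefficients. *)
Lemma chevalley_relation k (u s : 'I_k.+1 -> S) :
    (forall i, invariant (u i)) -> \sum_i s i * u i = 0 ->
    (forall c : 'I_k.+1 -> S, (forall i, invariant (c i)) ->
       \sum_i c i * u i = 0 -> (c ord0)@_0 = 0) ->
  hilbert_ideal (s ord0).
Proof.
move=> Iu rel_s Hmin; have [m] := ubnP (msize (s ord0)).
elim: m => // m IHm in s rel_s *; rewrite ltnS => le_m.
have [->|nzs] := eqVneq (s ord0) 0; first exact: ideal0.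
have act_rel g : g \in G -> \sum_i act g (s i) * u i = 0.
  move=> Gg; have := congr1 (act g) rel_s; rewrite mpoly_act0 mpoly_act_sum.
  by move=> E; rewrite -[RHS]E; apply: eq_bigr => i _; rewrite mpoly_actM Iu.
have HX r : r \in X -> hilbert_ideal (act r (s ord0) - s ord0).
  move=> Xr; have Gr := subsetP sub_genX _ Xr; have [c rc] := rootX Xr.
  have [nz _] := rc.
  have [t tE] := boolp.choice (fun i => root_of_act_sub (s i) rc).
  rewrite tE; apply: idealM; apply: IHm => //.
    have : linform c * (\sum_i t i * u i) = 0.
      transitivity (\sum_i act r (s i) * u i - \sum_i s i * u i); last first.
        by rewrite act_rel // rel_s subrr.
      rewrite mulr_sumr -sumrB.
      by apply: eq_bigr => i _; rewrite mulrA -tE mulrBl.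
    by move/eqP; rewrite mulf_eq0 linform_eq0 (negPf nz) => /eqP.
  have [->|nzt] := eqVneq (t ord0) 0.
    by rewrite msize0 (leq_trans _ le_m) // lt0n msize_poly_eq0.
  apply: leq_trans le_m.
  rewrite (leq_trans _ (_ : msize (act r (s ord0) - s ord0) <= _)%N) //.
    by rewrite tE msizeM ?linform_eq0 // linform_msize.
  by apply: leq_trans (msizeD_le _ _) _; rewrite msizeN geq_max mpoly_act_msize leqnn.
have HG g : g \in G -> hilbert_ideal (act g (s ord0) - s ord0).
  move: g; apply: (gen_subset_ind genX) => [|g h Gg Gh Hg Hh|r Xr]; last exact: HX.
    by rewrite mpoly_act_id subrr; apply: ideal0.
  have -> : act (g * h)%g (s ord0) - s ord0 =
      act g (act h (s ord0) - s ord0) + (act g (s ord0) - s ord0).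
    by rewrite (mpoly_act_mul _ Gg Gh) mpoly_actB addrA subrK.
  by apply: idealD Hg; apply: hilbert_ideal_act.
have avg0 : (orbit_sum (s ord0))@_0 = 0.
  apply: (Hmin (fun i => orbit_sum (s i))) => [i|]; first exact: orbit_sum_invariant.
  have := congr1 orbit_sum rel_s; rewrite orbit_sum0 => E; rewrite -[RHS]E.
  rewrite {2}/orbit_sum; under [RHS]eq_bigr do rewrite mpoly_act_sum.
  rewrite exchange_big; apply: eq_bigr => i _.
  by rewrite -orbit_sumM.
have -> : s ord0 = (#|G|%:R^-1)%:MP *
    (orbit_sum (s ord0) - \sum_(g in G) (act g (s ord0) - s ord0)).
  rewrite sumrB opprB addrC subrK sumr_const -scaler_nat mul_mpolyC scalerA.
  by rewrite mulVf ?card_neq0 // scale1r.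
apply: idealM; apply: idealB; last exact: ideal_sum.
by apply: ideal_gen; split=> //; apply: orbit_sum_invariant.
Qed.

(** Chevalley's argument: relations with invariant coefficients come from
    relations modulo the Hilbert ideal.  A coefficient which, up to a factor with
    nonzero constant term, is a combination of the others is eliminated;
    [chevalley_relation] applies when there is none. *)
Lemma dependent_mod_hilbert k m (om : 'I_k -> 'I_m -> S) (u : 'I_k -> S) :
    (forall i, invariant (u i)) -> (forall j, \sum_i u i * om i j = 0) ->
    (exists i, u i != 0) ->
  exists2 c : 'I_k -> C, exists i, c i != 0
    & forall j, hilbert_ideal (\sum_i c i *: om i j).
Proof.
elim: k => [|k IHk] in om u *; first by move=> _ _ [[]].
move=> Iu rel_u [i0 nz_u].
have [Hmin|] := pselect (forall c : 'I_k.+1 -> S, (forall i, invariant (c i)) ->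
       \sum_i c i * u i = 0 -> (c ord0)@_0 = 0).
  exists (fun i => (i == ord0)%:R); first by exists ord0; rewrite eqxx oner_eq0.
  move=> j; rewrite (bigD1 ord0) //= scale1r big1 ?addr0; last first.
    by move=> i /negPf ->; rewrite scale0r.
  apply: (chevalley_relation Iu (s := fun i => om i j)) => //.
  by rewrite -[RHS](rel_u j); apply: eq_bigr => i _; rewrite mulrC.
move=> /existsNP [c /not_implyP [Ic /not_implyP [rel_c /eqP nz_c]]].
pose up := lift (@ord0 k).
pose om' i j := c ord0 * om (up i) j - c (up i) * om ord0 j.
have [|||b [i1 nz_b] Hb] := IHk om' (fun i => u (up i)).
- by move=> i; apply: Iu.
- move=> j; rewrite /om'; under eq_bigr do rewrite mulrBr.
  rewrite sumrB; apply/eqP; rewrite subr_eq0; apply/eqP.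
  transitivity (- (c ord0 * u ord0 * om ord0 j)).
    apply/eqP; rewrite -addr_eq0 -mulrA; apply/eqP.
    under eq_bigr do rewrite mulrCA.
    rewrite -mulr_sumr -mulrDr addrC; have := rel_u j.
    by rewrite big_ord_recl => ->; rewrite mulr0.
  under [RHS]eq_bigr do rewrite mulrA.
  rewrite -mulr_suml -mulNr; congr (_ * _).
  have /eqP := rel_c; rewrite big_ord_recl addr_eq0 => /eqP ->.
  by rewrite opprK; apply: eq_bigr => i _; rewrite mulrC.
- apply: contrapT => /forallNP nu; case/negP: nz_u.
  have u0 i : u (up i) = 0 by apply/eqP/negPn/negP/nu.
  have [i|->] := unliftP ord0 i0; first by move=> ->; rewrite u0.
  move/eqP: rel_c; rewrite big_ord_recl big1 => [|i _]; last by rewrite u0 mulr0.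
  rewrite addr0 mulf_eq0 => /orP[/eqP c0|//].
  by rewrite c0 mcoeff0 eqxx in nz_c.
pose c' i := if unlift ord0 i is Some i' then (c ord0)@_0 * b i'
             else - \sum_i b i * (c (up i))@_0.
(* modulo the Hilbert ideal the invariants [c i] act through their constant terms *)
exists c'; first by exists (up i1); rewrite /c' liftK mulf_neq0.
move=> j; pose lo p : S := p - (p@_0)%:MP.
have Ilo p : invariant p -> hilbert_ideal (lo p).
  move=> Ip; apply: ideal_gen; split; first exact/invariantB/invariantC.
  by rewrite mcoeffB mcoeffC eqxx mulr1 subrr.
have -> : \sum_i c' i *: om i j = \sum_i b i *: om' i j
    - (\sum_i b i *: (lo (c ord0) * om (up i) j - lo (c (up i)) * om ord0 j)).
  rewrite -sumrB big_ord_recl /c' unlift_none.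
  under [X in _ + X = _]eq_bigr => i _ do rewrite liftK.
  rewrite scaleNr scaler_suml -sumrN -big_split /=; apply: eq_bigr => i _.
  by rewrite /om' /lo -!mul_mpolyC !mpolyCM; ring.
apply: idealB; first exact: Hb.
apply: ideal_sum => i _; rewrite -mul_mpolyC; apply: idealM.
by apply: idealB; apply: idealMr; apply: Ilo.
Qed.

End Invariants.

(** * The Jacobian of the basic invariants *)

Lemma ideal_finE (T : comNzRingType) (I : finType) (F : I -> T) p :
  ideal (fun u => exists i, u = F i) p -> exists s : I -> T, p = \sum_i s i * F i.
Proof.
elim=> [|s u q _ [j ->] _ [t ->]].
  by exists (fun=> 0); rewrite big1 // => i _; rewrite mul0r.
exists (fun i => (i == j)%:R * s + t i).
under [RHS]eq_bigr do rewrite mulrDl.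
rewrite big_split /=; congr (_ + _); rewrite (bigD1 j) //= eqxx mul1r.
by rewrite big1 ?addr0 // => i /negPf ->; rewrite !mul0r.
Qed.

Lemma monic_root_pow (T : comNzRingType) (I : finType) (A : {set I}) (F : I -> T) i :
    i \in A ->
  F i ^+ #|A| =
    - \sum_(k < #|A|) (\prod_(j in A) ('X - (F j)%:P))`_k * F i ^+ k.
Proof.
move=> Ai; set P := \prod_(j in A) _.
have P0 : P.[F i] = 0.
  by rewrite horner_prod (big_setD1 i Ai) /= hornerXsubC subrr mul0r.
have P_monic : P \is monic by apply: monic_prod_XsubC.
have size_P : size P = #|A|.+1.
  by rewrite /P -big_enum size_prod_XsubC /= -cardE.
apply/eqP; rewrite -addr_eq0; apply/eqP; rewrite -[RHS]P0 horner_coef size_P.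
rewrite big_ord_recr addrC; congr (_ + _) => /=.
by have := monicP P_monic; rewrite lead_coefE size_P /= => ->; rewrite mul1r.
Qed.

Section Jacobian.
Variables (C : numFieldType) (gT : finGroupType) (G : {group gT}) (n : nat).
Variable rG : mx_representation C G n.
Local Notation S := {mpoly C[n]}.
Local Notation act := (mpoly_act rG).
Local Notation invariant := (mpoly_invariant rG).
Implicit Types (p q s u : S) (g h r : gT) (v : 'rV[C]_n) (c : 'cV[C]_n).

(** Each coordinate [x] is a root of the monic polynomial whose roots are the
    conjugates of [x], and the lower coefficients of that polynomial are
    invariants without constant term. *)
Lemma Xpow_hilbert_ideal i : hilbert_ideal rG ('X_i ^+ #|G|).
Proof.
pose P : {poly S} := \prod_(g in G) ('X - (act g 'X_i)%:P).
have P_inv k : invariant P`_k.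
  move=> h Gh; pose ah : {rmorphism S -> S} := comp_mpoly
    [tuple \sum_(j < n) rG h j i *: 'X_j | i < n].
  have E : P = map_poly ah P; last by rewrite [in RHS]E coef_map.
  rewrite rmorph_prod /= [LHS](reindex_inj (mulgI h)) /=.
  apply: eq_big => g; first by rewrite groupMl.
  rewrite groupMl // => Gg.
  by rewrite rmorphB /= map_polyX map_polyC /= mpoly_act_mul.
have P_low k : (k < #|G|)%N -> (P`_k)@_0 = 0.
  move=> lt_k; rewrite -[LHS](coef_map (mcoeff 0%MM)) rmorph_prod /=.
  rewrite (eq_bigr (fun=> 'X)) => [|g Gg].
    by rewrite prodr_const coefXn (ltn_eqF lt_k).
  rewrite rmorphB /= map_polyX map_polyC /= mpoly_act_const mcoeffX mnm1_eq0.
  by rewrite subr0.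
have := monic_root_pow (fun g => act g 'X_i) (group1 G).
rewrite -/P mpoly_act_id => ->.
apply: idealN; apply: ideal_sum => k _; apply: idealMr.
by apply: ideal_gen; split; [apply: P_inv | apply: P_low].
Qed.

Lemma mderiv_invariant p g k : invariant p -> g \in G ->
  p^`M(k) = \sum_j act g p^`M(j) * (rG g k j)%:MP.
Proof.
move=> Ip Gg; rewrite -{1}(Ip g Gg) mderiv_comp; apply: eq_bigr => j _.
rewrite tnth_mktuple; congr (_ * _); rewrite raddf_sum (bigD1 k) //=.
rewrite big1 => [|l ne]; last first.
  by rewrite mderivZ mderivX mnm1E (negPf ne) scale0r scaler0.
rewrite addr0 mderivZ mderivX mnm1E eqxx scale1r -{1}[U_(k)%MM]addm0 addmC.
by rewrite addmK mpolyX0 -mul_mpolyC mulr1.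
Qed.

Variables (d : n.-tuple nat) (f : n.-tuple S).
Hypothesis f_homog : forall i, tnth f i \is (tnth d i).-homog.
Hypothesis f_indep : alg_independent f.
Hypothesis f_gen : generates_invariants rG f.

Lemma basic_invariant i : invariant (tnth f i).
Proof. by apply/f_gen; exists 'X_i; rewrite comp_mpolyXi. Qed.

Lemma degree_gt0 i : (0 < tnth d i)%N.
Proof.
rewrite lt0n; apply/negP => /eqP d0; have := f_homog i; rewrite d0.
move/dhomog0_const => fE.
have /f_indep /(congr1 (mcoeff U_(i))) :
    ('X_i - ((tnth f i)@_0)%:MP : S) \mPo f = 0.
  by rewrite comp_mpolyB comp_mpolyXi comp_mpolyC -fE subrr.
rewrite mcoeffB mcoeffXU eqxx mcoeffC mnm1_eq0 mulr0 subr0 mcoeff0.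
by move/eqP; rewrite oner_eq0.
Qed.

Lemma basic_invariant_const i : (tnth f i)@_0 = 0.
Proof.
by apply: (dhomog_nemf_coeff (f_homog i)); rewrite /= mdeg0 eq_sym -lt0n degree_gt0.
Qed.

Lemma hilbert_ideal_basic p :
  hilbert_ideal rG p -> ideal (fun u => exists i, u = tnth f i) p.
Proof.
apply: ideal_mono => u [/f_gen [q uE] u0].
have : ideal (fun u => exists i, u = tnth f i)
    ((q \mPo f) - (q \mPo [tuple 0 | i < n])).
  apply: comp_mpoly_congr => i; rewrite tnth_mktuple subr0.
  by apply: ideal_gen; exists i.
rewrite comp_mpoly0E -uE => Hu.
have : (u - (q@_0)%:MP)@_0 = 0.
  elim: Hu => [|s _ p' _ [i ->] _ IH]; first exact: mcoeff0.
  by rewrite mcoeffD IH rmorphM /= basic_invariant_const mulr0 addr0.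
rewrite mcoeffB mcoeffC eqxx mulr1 u0 sub0r => /eqP.
by rewrite oppr_eq0 => /eqP q0; rewrite q0 mpolyC0 subr0 in Hu.
Qed.

Definition jacobian : 'M[S]_n := \matrix_(i, j) (tnth f i)^`M(j).

(** By Euler's formula the rows of the Jacobian express the [f i] through the
    coordinates, and by [Xpow_hilbert_ideal] powers of the coordinates are
    combinations of the [f i]. *)
Lemma jacobian_notin_hilbert : ~ hilbert_ideal rG (\det jacobian).
Proof.
pose F : 'cV[S]_n := \col_i tnth f i.
move=> /hilbert_ideal_basic HJ.
have [D DE] : exists D : 'I_n -> 'I_n -> S,
    forall i, 'X_i ^+ #|G| = \sum_j D i j * tnth f j.
  have [D DE] := boolp.choice (fun i =>
    ideal_finE (hilbert_ideal_basic (Xpow_hilbert_ideal i))).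
  by exists D.
pose e : 'rV[S]_n := \row_i ((tnth d i)%:R^-1)%:MP.
apply: (@det_notin_ideal _ _ #|G| F (diag_mx e *m jacobian) (\matrix_(i, j) D i j)).
- exact: cardG_gt0.
- apply/matrixP => i k; rewrite ord1 -mulmxA mul_diag_mx !mxE.
  rewrite (eq_bigr (fun j => 'X_j * (tnth f i)^`M(j))) => [|j _]; last first.
    by rewrite !mxE mulrC.
  rewrite (mpoly_euler (f_homog i)) mul_mpolyC scalerA mulVf ?scale1r //.
  by rewrite pnatr_eq0 -lt0n degree_gt0.
- apply/matrixP => i k; rewrite ord1 !mxE DE.
  by apply: eq_bigr => j _; rewrite !mxE.
rewrite det_mulmx; apply/idealM; apply: ideal_mono HJ => _ [i ->].
by apply: ideal_gen; exists i; rewrite mxE.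
Qed.

Lemma jacobian_neq0 : \det jacobian != 0.
Proof.
by apply/eqP => J0; apply: jacobian_notin_hilbert; rewrite J0; apply: ideal0.
Qed.

Lemma jacobian_act g : g \in G ->
  jacobian = map_mx (act g) jacobian *m (map_mx (@mpolyC n C) (rG g))^T.
Proof.
move=> Gg; apply/matrixP => i k; rewrite !mxE.
rewrite {1}(mderiv_invariant k (basic_invariant i) Gg).
by apply: eq_bigr => j _; rewrite !mxE.
Qed.

Lemma det_jacobian_act g : g \in G ->
  act g (\det jacobian) = (\det (rG g))^-1 *: \det jacobian.
Proof.
move=> Gg.
have nz : \det (rG g) != 0 by rewrite -unitfE -unitmxE repr_mx_unit.
rewrite {2}(jacobian_act Gg) det_mulmx det_tr.
rewrite [\det (map_mx (@mpolyC n C) _)](det_map_mx (@mpolyC n C)).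
rewrite [\det (map_mx (act g) _)](det_map_mx
  (comp_mpoly [tuple \sum_(j < n) rG g j i *: 'X_j | i < n])) /=.
by rewrite mulrC mul_mpolyC scalerA mulVf // scale1r.
Qed.

(** An element of [G] that fixes [v] also fixes the differentials of the [f i] at [v],
    and these span the dual space. *)
Lemma jacobian_free v g : \det (map_mx (meval (v 0)) jacobian) != 0 ->
  g \in G -> v *m rG g = v -> rG g = 1%:M.
Proof.
move=> nz Gg vg; set Jv := map_mx _ _ in nz.
have uJ : Jv \in unitmx by rewrite unitmxE unitfE.
have E : Jv = Jv *m (rG g)^T.
  rewrite {1}/Jv (jacobian_act Gg) map_mxM; congr (_ *m _).
    by apply/matrixP => i j; rewrite !mxE /= mpoly_act_eval vg.
  by apply/matrixP => i j; rewrite !mxE /= mevalC.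
apply: trmx_inj; rewrite trmx1; apply: (can_inj (mulKmx uJ)).
by rewrite -E mulmx1.
Qed.

Definition is_root c := exists2 r, r \in G & root_of rG r c.

Lemma is_root_act g c : g \in G -> is_root c -> is_root (rG g *m c).
Proof.
move=> Gg [r Gr [nz [u nzu rE]]]; have uG := repr_mx_unit rG Gg.
exists (g * r * g^-1)%g; first by rewrite !groupM ?groupV.
split; first by apply: contraNneq nz => E; rewrite -(mulKmx uG c) E mulmx0.
exists (u *m rG (g^-1)%g).
  apply: contraNneq nzu => E; rewrite -[u](mulmxKV uG) -?repr_mxV //.
  by rewrite E mul0mx.
rewrite !repr_mxM ?groupM ?groupV // rE mulmxDr mulmx1 mulmxDl.
by rewrite repr_mxV // mulmxV // !mulmxA.
Qed.

Definition root_free q := forall c t, is_root c -> q <> linform c * t.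

Lemma root_factorization q : q != 0 -> exists cs : seq 'cV[C]_n, exists q',
  [/\ forall c, c \in cs -> is_root c, q = (\prod_(c <- cs) linform c) * q'
    & root_free q'].
Proof.
have [m] := ubnP (msize q); elim: m => // m IHm in q *; rewrite ltnS => le_m nz.
have [[[c t] /= [rc qE]]|Hfree] := pselect (exists ct : 'cV_n * S,
    is_root ct.1 /\ q = linform ct.1 * ct.2); last first.
  exists [::], q; split=> //; first by rewrite big_nil mul1r.
  by move=> c t rc qE; apply: Hfree; exists (c, t).
have [_ _ [nzc _]] := rc.
have nzt : t != 0 by apply: contraNneq nz => t0; rewrite qE t0 mulr0.
have [||cs [q' [rcs tE freeq']]] := IHm t => //.
  by move: le_m; rewrite qE msizeM ?linform_eq0 // linform_msize.
exists (c :: cs), q'; split=> //; last by rewrite big_cons -mulrA -tE.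
by move=> c'; rewrite inE => /orP[/eqP ->|/rcs].
Qed.

Lemma root_free_cancel (cs : seq 'cV[C]_n) q s t : q != 0 ->
    (forall c, c \in cs -> is_root c) -> root_free q ->
  q * s = (\prod_(c <- cs) linform c) * t -> exists t', t = q * t'.
Proof.
move=> nz; elim: cs s => [|c cs IHcs] s rcs freeq.
  by rewrite big_nil mul1r => <-; exists s.
have rc : is_root c by apply: rcs; rewrite mem_head.
have [_ _ [nzc _]] := rc.
rewrite big_cons -mulrA => E.
have [[q' qE]|[s' sE]] := linform_prime nzc E; first by case: (freeq c q').
apply: (IHcs s') => // [c' c'cs|]; first by apply: rcs; rewrite inE c'cs orbT.
apply: (mulfI (x := linform c)); first by rewrite linform_eq0.
by rewrite -E sE mulrCA.
Qed.

Variable X : {set gT}.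
Hypothesis genX : <<X>>%g = G.
Hypothesis rootX : forall r, r \in X -> exists c, root_of rG r c.

(** Reflections permute the root forms up to scalars.  They hence fix the root
    free part up to scalars, and the scalars are 1 because the two sides agree
    on the hyperplane of the reflection. *)
Lemma root_free_invariant (cs : seq 'cV[C]_n) q :
    (forall c, c \in cs -> is_root c) -> root_free q -> q != 0 ->
    (forall g, g \in G -> exists2 a : C, a != 0 &
       act g ((\prod_(c <- cs) linform c) * q) = a *: ((\prod_(c <- cs) linform c) * q)) ->
  invariant q.
Proof.
move=> rcs freeq nz semi.
have HX r : r \in X -> act r q = q.
  move=> Xr; have Gr := subsetP (sub_genX genX) _ Xr.
  have [a nza E] := semi r Gr.
  have [t qt] : exists t, act r q = q * t.
    apply: (@root_free_cancel [seq rG r *m c | c <- cs] q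
      (a *: \prod_(c <- cs) linform c)) => //.
      by move=> _ /mapP[c /rcs rc ->]; apply: is_root_act.
    rewrite -scalerAr [q * _]mulrC -E mpoly_actM big_map; congr (_ * _).
    rewrite {1}/mpoly_act rmorph_prod; apply: eq_bigr => c _.
    exact: mpoly_act_linform.
  have nzt : t != 0.
    apply: contraNneq nz => t0; rewrite -(mpoly_act_eq0 rG q Gr) qt t0.
    by rewrite mulr0.
  have tE : t = (t@_0)%:MP.
    apply: msize1_polyC; have := mpoly_act_msize rG r q; rewrite qt msizeM //.
    have : (0 < msize q)%N by rewrite lt0n msize_poly_eq0.
    by move: (msize q) (msize t) => a1 a2; lia.
  have [c rc] := rootX Xr; have [t' E'] := root_of_act_sub q rc.
  have qb : act r q = t@_0 *: q by rewrite qt {1}tE mulrC mul_mpolyC.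
  have [b1|b1] := eqVneq (t@_0) 1; first by rewrite qb b1 scale1r.
  have nzb : t@_0 - 1 != 0 by rewrite subr_eq0.
  case: (freeq c ((t@_0 - 1)^-1 *: t')); first by exists r.
  rewrite -scalerAr -E' qb -{3}[q]scale1r -scalerBl scalerA.
  by rewrite mulVf ?scale1r.
apply: (gen_subset_ind genX) => [|g h Gg Gh Hg Hh|]; last exact: HX.
  exact: mpoly_act_id.
by rewrite (mpoly_act_mul rG q Gg Gh) Hh Hg.
Qed.

(** The root free part of the Jacobian is an invariant, and has a nonzero constant
    term because the Jacobian is not in the Hilbert ideal.  So it does not vanish
    identically on the line through [v], and neither do the root forms. *)
Lemma jacobian_regular v :
    (forall c, is_root c -> (v *m c) 0 0 != 0) ->
  \det (map_mx (meval (v 0)) jacobian) != 0.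
Proof.
move=> regv; have [cs [q [rcs JE freeq]]] := root_factorization jacobian_neq0.
have nzq : q != 0.
  by apply: contraNneq jacobian_neq0 => q0; rewrite JE q0 mulr0.
have Iq : invariant q.
  apply: (root_free_invariant rcs freeq nzq) => g Gg; rewrite -JE.
  exists (\det (rG g))^-1; last exact: det_jacobian_act.
  by rewrite invr_eq0 -unitfE -unitmxE repr_mx_unit.
have q0 : q@_0 != 0.
  apply/eqP => q0; apply: jacobian_notin_hilbert; rewrite JE.
  by apply/idealM/ideal_gen.
(* the entries of the Jacobian are homogeneous, of the same degree in each row *)
have lineJ : on_line v (\det jacobian) =
    (\prod_i 'X^((tnth d i).-1)) * (\det (map_mx (meval (v 0)) jacobian))%:P.
  rewrite -det_map_mx -[(\det _)%:P]det_map_mx.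
  rewrite (_ : \prod_i _ = \prod_i (\row_i 'X^((tnth d i).-1) : 'rV[{poly C}]_n) 0 i).
    rewrite -det_diag -det_mulmx; congr (\det _); apply/matrixP => i j.
    rewrite mul_diag_mx !mxE /= (on_line_homog v (mderiv_homog j (f_homog i))).
    by rewrite mulrC mul_polyC.
  by apply: eq_bigr => i _; rewrite mxE.
apply/eqP => Jv0; have /eqP : on_line v (\det jacobian) = 0.
  by rewrite lineJ Jv0 polyC0 mulr0.
rewrite JE rmorphM mulf_eq0 => /orP[]; last first.
  by move/eqP/(congr1 (fun p : {poly C} => p`_0)); rewrite on_line_const coef0; apply/eqP.
rewrite rmorph_prod prodf_seq_eq0 => /hasP[c /rcs rc /=].
have homc : linform c \is 1.-homog.
  by apply: rpred_sum => j _; apply: rpredZ; rewrite dhomogX /= mdeg1.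
rewrite (on_line_homog v homc) linform_eval scaler_eq0 (negPf (regv c rc)) /=.
by rewrite -size_poly_eq0 size_polyXn.
Qed.

End Jacobian.

(** * Regular elements lie in no proper reflection subgroup *)

Section RegularElements.
Variables (C : numFieldType) (gT : finGroupType) (G H : {group gT}) (n : nat).
Variable rG : mx_representation C G n.
Hypothesis sHG : H \subset G.
Local Notation rH := (subg_repr rG sHG).
Local Notation S := {mpoly C[n]}.
Local Notation act := (mpoly_act rG).
Implicit Types (p q s u : S) (g h r : gT).

Variables (d : n.-tuple nat) (f : n.-tuple S).
Hypothesis f_homog : forall i, tnth f i \is (tnth d i).-homog.
Hypothesis f_indep : alg_independent f.
Hypothesis f_gen : generates_invariants rG f.

Variable X : {set gT}.
Hypothesis genX : <<X>>%g = H.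
Hypothesis rootX : forall r, r \in X -> exists c, root_of rH r c.

Variables (D : nat) (zeta : C) (v : 'rV[C]_n) (w : gT).
Hypothesis Hw : w \in H.
Hypothesis prim_zeta : D.-primitive_root zeta.
Hypothesis vw : v *m rG w = zeta *: v.
Hypothesis le_dD : forall i, (tnth d i <= D)%N.
Hypothesis regular_v : \det (map_mx (meval (v 0)) (jacobian f)) != 0.

Local Notation pos_comb := (combination (pos_invariant rH) (pos_invariant rH)).

Lemma invariant_sub p : mpoly_invariant rG p -> mpoly_invariant rH p.
Proof. by move=> Ip g Hg; apply: Ip; apply: (subsetP sHG). Qed.

(** The homogeneous part of degree [k] of an invariant is multiplied by
    [zeta ^+ k] when [v] is moved by [w], and is also invariant. *)
Lemma line_invariant_low u k :
  pos_invariant rH u -> (k < D)%N -> (on_line v u)`_k = 0.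
Proof.
move=> [Iu u0] lt_kD; have [->|k_gt0] := posnP k; first by rewrite on_line_const.
rewrite on_line_coef; set a := _.@[_].
have : zeta ^+ k * a = a.
  rewrite -(meval_homog_scale v zeta (pihomogP _ k u)) -vw.
  exact: (invariant_eval v (invariant_pihomog k Iu) Hw).
move/eqP; rewrite -subr_eq0 -{2}[a]mul1r -mulrBl mulf_eq0 => /orP[|/eqP //].
rewrite subr_eq0 -(prim_order_dvd prim_zeta) => /(dvdn_leq k_gt0).
by rewrite leqNgt lt_kD.
Qed.

(** On the line through [v] the differential of a product of two invariants
    without constant term vanishes to order at least [D], while that of a
    combination of the [f i] has degree less than [D]. *)
Lemma basic_independent (c : 'I_n -> C) :
  pos_comb (\sum_i c i *: tnth f i) -> forall i, c i = 0.
Proof.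
pose low (a : {poly C}) := forall k, (k < D)%N -> a`_k = 0.
have lowD a b : low a -> low b -> low (a + b).
  by move=> la lb k lt_k; rewrite coefD la ?lb ?addr0.
have lowM a b : low a -> low (b * a).
  move=> la k lt_k; rewrite coefM big1 // => i _.
  by rewrite la ?mulr0 // (leq_ltn_trans (leq_subr _ _)).
move=> Hc; have low_j j : low (on_line v (\sum_i c i *: tnth f i)^`M(j)).
  elim: Hc => [|s u p Ps Pu _ IH]; first by move=> k _; rewrite mderiv0 rmorph0 coef0.
  rewrite mderivD mderivM !rmorphD !rmorphM /=; apply: (lowD) => //; apply: lowD.
    by apply: (lowM) => k; apply: line_invariant_low.
  by rewrite mulrC; apply: (lowM) => k; apply: line_invariant_low.
suff c0 : \row_i c i *m map_mx (meval (v 0)) (jacobian f) = 0.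
  move=> i; have /rowP /(_ i) : \row_i c i = 0; last by rewrite !mxE.
  have uJ : map_mx (meval (v 0)) (jacobian f) \in unitmx by rewrite unitmxE unitfE.
  by rewrite -(mulmxK uJ (\row_i c i)) c0 mul0mx.
apply/rowP => j; rewrite !mxE.
pose a : {poly C} := \sum_i (c i * ((tnth f i)^`M(j)).@[v 0]) *: 'X^((tnth d i).-1).
have aE : on_line v (\sum_i c i *: tnth f i)^`M(j) = a.
  have -> : (\sum_i c i *: tnth f i)^`M(j) = \sum_i (c i *: tnth f i)^`M(j).
    by rewrite raddf_sum.
  rewrite rmorph_sum /=; apply: eq_bigr => i _.
  by rewrite mderivZ on_lineZ (on_line_homog v (mderiv_homog j (f_homog i))) scalerA.
have a0 : a = 0.
  apply/polyP => k; rewrite coef0; have [lt_k|le_k] := ltnP k D.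
    by rewrite -aE; apply: low_j.
  rewrite coef_sum big1 // => i _; rewrite coefZ coefXn gtn_eqF ?mulr0 //.
  have := degree_gt0 f_homog f_indep i; have := le_dD i.
  by move: (tnth d i) le_k => di; lia.
transitivity a.[1]; last by rewrite a0 horner0.
rewrite horner_sum; apply: eq_bigr => i _; rewrite !mxE.
by rewrite hornerZ hornerXn expr1n mulr1.
Qed.

(** Averaging makes the coefficients invariant, and multiplies [p] by a scalar. *)
Lemma pos_comb_orbit_sum p : mpoly_invariant rH p ->
  combination (fun s => s@_0 = 0) (pos_invariant rH) p -> pos_comb p.
Proof.
move=> Ip Hp; have -> : p = (#|H|%:R^-1)%:MP * orbit_sum rH p.
  by rewrite orbit_sum_id // mul_mpolyC scalerA mulVf ?scale1r // card_neq0.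
have := orbit_sum_combination (rG := rH) (fun u (Pu : pos_invariant rH u) => Pu.1) Hp.
apply: combination_mull => _ [t t0 ->]; split.
  by apply/invariantM/orbit_sum_invariant/invariantC.
by rewrite rmorphM /= orbit_sum_const t0 !mulr0.
Qed.

(** The differentials of the [f i] and of [p] are [n.+1] vectors of size [n], so
    that they are linearly dependent.  Multiplying by the conjugates of the
    Jacobian and averaging, the coefficients are made invariant. *)
Lemma invariant_mod_squares p m : (0 < m)%N -> p \is m.-homog ->
    mpoly_invariant rH p ->
  exists c : 'I_n -> C, pos_comb (p - \sum_i c i *: tnth f i).
Proof.
move=> m_gt0 hp Ip; pose J := jacobian f; pose Jd := \det J.
have nzJ : Jd != 0 by apply: contraNneq regular_v => J0; rewrite det_map_mx -/Jd J0 rmorph0.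
(* the index [ord0] is that of [p], the others are those of the basic invariants *)
pose q i := if unlift ord0 i is Some i' then tnth f i' else p : S.
pose e i := if unlift ord0 i is Some i' then tnth d i' else m.
have q0 : q ord0 = p by rewrite /q unlift_none.
have qS i : q (lift ord0 i) = tnth f i by rewrite /q liftK.
have Iq i : mpoly_invariant rH (q i).
  by rewrite /q; case: unliftP => // j _; apply/invariant_sub/basic_invariant.
have hq i : q i \is (e i).-homog by rewrite /q /e; case: unliftP.
(* Cramer's rule *)
pose s := (\row_j p^`M(j)) *m \adj J.
pose u0 i := if unlift ord0 i is Some i' then - s 0 i' else Jd.
have rel0 j : \sum_i u0 i * (q i)^`M(j) = 0.
  rewrite big_ord_recl q0 {1}/u0 unlift_none.
  under eq_bigr => i _ do rewrite qS /u0 liftK mulNr.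
  rewrite sumrN; apply/eqP; rewrite subr_eq0; apply/eqP.
  transitivity ((s *m J) 0 j); last first.
    by rewrite mxE; apply: eq_bigr => i _; congr (_ * _); rewrite mxE.
  by rewrite /s -mulmxA mul_adj_mx mul_mx_scalar !mxE.
(* the factor [y] turns the coefficient of [p] into a norm, so that its average
   does not vanish *)
pose norm := \prod_(h in H) act h Jd.
pose y := \prod_(h in H :\ 1%g) act h Jd.
have normE : y * Jd = norm.
  by rewrite /norm (big_setD1 1%g (group1 H)) /= mpoly_act_id mulrC.
have nz_norm : norm != 0.
  apply/prodf_neq0 => h Hh; rewrite mpoly_act_eq0 //; exact: (subsetP sHG).
have I_norm : mpoly_invariant rH norm.
  move=> g Hg; rewrite /norm {1}/mpoly_act rmorph_prod /=.
  rewrite [RHS](reindex_inj (mulgI g)) /=; apply: eq_big => h.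
    by rewrite groupMl.
  move=> Hh; rewrite (mpoly_act_mul rG) //; exact: (subsetP sHG).
pose u i := orbit_sum rH (y * u0 i).
have Iu i : mpoly_invariant rH (u i) by apply: orbit_sum_invariant.
have rel_u j : \sum_i u i * (q i)^`M(j) = 0.
  under eq_bigr => i _ do rewrite /u mulr_suml.
  rewrite exchange_big big1 // => g Hg /=.
  rewrite (eq_bigr (fun i => \sum_k
     mpoly_act rH g (y * u0 i * (q i)^`M(k)) * (rH g j k)%:MP)); last first.
    move=> i _; rewrite (mderiv_invariant j (Iq i) Hg) mulr_sumr.
    by apply: eq_bigr => k _; rewrite mulrA -mpoly_actM.
  rewrite exchange_big big1 // => k _ /=; rewrite -mulr_suml -mpoly_act_sum.
  have -> : \sum_i y * u0 i * (q i)^`M(k) = y * \sum_i u0 i * (q i)^`M(k).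
    by rewrite mulr_sumr; apply: eq_bigr => i _; rewrite mulrA.
  by rewrite rel0 mulr0 mpoly_act0 mul0r.
have nz_u : exists i, u i != 0.
  exists ord0; rewrite /u /u0 unlift_none normE orbit_sum_id //.
  by rewrite scaler_eq0 negb_or nz_norm card_neq0.
have [c [i1 nz_c] Hc] := dependent_mod_hilbert genX rootX
  (om := fun i j => (q i)^`M(j)) Iu rel_u nz_u.
(* Euler's formula *)
have Hq : pos_comb (\sum_i (c i * (e i)%:R) *: q i).
  apply: pos_comb_orbit_sum.
    by apply: invariant_sum => i _; apply: invariantZ.
  have -> : \sum_i (c i * (e i)%:R) *: q i =
      \sum_j 'X_j * \sum_i c i *: (q i)^`M(j).
    under [RHS]eq_bigr do rewrite mulr_sumr.
    rewrite exchange_big; apply: eq_bigr => i _ /=.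
    rewrite -scalerA -(mpoly_euler (hq i)) scaler_sumr.
    by apply: eq_bigr => j _; rewrite scalerAr.
  apply: combination_sum => j _; apply: combination_mull (Hc j) => t _.
  by rewrite rmorphM /= mcoeffX mnm1_eq0 mul0r.
rewrite big_ord_recl q0 {1}/e unlift_none in Hq.
have sumE : \sum_(i < n) (c (lift ord0 i) * (e (lift ord0 i))%:R) *: q (lift ord0 i) =
    \sum_i (c (lift ord0 i) * (tnth d i)%:R) *: tnth f i.
  by apply: eq_bigr => i _; rewrite qS /e liftK.
rewrite {}sumE in Hq.
have [c0|c0] := eqVneq (c ord0) 0.
  rewrite c0 mul0r scale0r add0r in Hq; have cd0 := basic_independent Hq.
  have [i E|E] := unliftP ord0 i1; last by rewrite E c0 eqxx in nz_c.
  have /eqP := cd0 i; rewrite mulf_eq0 -E (negPf nz_c) pnatr_eq0.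
  by rewrite (gtn_eqF (degree_gt0 f_homog f_indep i)).
have nz_cm : c ord0 * m%:R != 0 by rewrite mulf_neq0 // pnatr_eq0 -lt0n.
exists (fun i => - ((c ord0 * m%:R)^-1 * (c (lift ord0 i) * (tnth d i)%:R))).
have -> :
  p - \sum_i - ((c ord0 * m%:R)^-1 * (c (lift ord0 i) * (tnth d i)%:R)) *: tnth f i =
    ((c ord0 * m%:R)^-1)%:MP * ((c ord0 * m%:R) *: p +
        \sum_i (c (lift ord0 i) * (tnth d i)%:R) *: tnth f i).
  rewrite mul_mpolyC scalerDr scalerA mulVf // scale1r; congr (_ + _).
  rewrite scaler_sumr -sumrN; apply: eq_bigr => i _.
  by rewrite scaleNr opprK scalerA.
apply: combination_mull Hq => t [It t0]; split; first by apply/invariantM/It/invariantC.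
by rewrite rmorphM /= t0 mulr0.
Qed.

(** Induction on the degree: in a product of two invariants without constant term,
    the homogeneous parts that contribute to degree [m] have degree less than [m]. *)
Lemma invariant_homog_eq p m :
  p \is m.-homog -> mpoly_invariant rH p -> mpoly_invariant rG p.
Proof.
have [M] := ubnP m; elim: M => // M IHM in p m *; rewrite ltnS => le_m hp Ip.
have [m0|m_gt0] := posnP m.
  by rewrite m0 in hp; rewrite (dhomog0_const hp); apply: invariantC.
have [c Hc] := invariant_mod_squares m_gt0 hp Ip.
have I0 : mpoly_invariant rG 0 by rewrite -mpolyC0; apply: invariantC.
rewrite -(pihomog_dE hp) -[X in pihomog _ _ X](subrK (\sum_i c i *: tnth f i)).
rewrite raddfD /=; apply: invariantD; last first.
  apply/invariant_pihomog/invariant_sum => i _.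
  by apply/invariantZ/basic_invariant.
elim: Hc => [|s u q [Is s0] [Iu u0] _ IH].
  by rewrite raddf0; apply: I0.
rewrite raddfD /=; apply: invariantD => //.
rewrite {1}(pihomog_partitionE (leqnn (msize s))) mulr_suml raddf_sum.
apply: invariant_sum => a _ /=.
rewrite {1}(pihomog_partitionE (leqnn (msize u))) mulr_sumr raddf_sum.
apply: invariant_sum => b _ /=.
have hab := dhomogM (pihomogP mdeg a s) (pihomogP mdeg b u).
have [Eab|ne_ab] := eqVneq (a + b)%N m; last by rewrite (pihomog_ne0 ne_ab hab).
rewrite -Eab (pihomog_dE hab).
have z0 (t : S) : t@_0 = 0 -> pihomog mdeg 0 t = 0.
  move=> t0; rewrite (dhomog0_const (pihomogP _ 0 t)) -(on_line_const v).
  by rewrite on_line_coef pihomog_id -on_line_coef on_line_const t0 mpolyC0.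
have [a0|a_gt0] := posnP a; first by rewrite a0 z0 // mul0r.
have [b0|b_gt0] := posnP b; first by rewrite b0 z0 // mulr0.
apply: invariantM.
  apply: (IHM _ a); [by lia | exact: pihomogP | exact: invariant_pihomog].
apply: (IHM _ b); [by lia | exact: pihomogP | exact: invariant_pihomog].
Qed.

Lemma invariant_eq p : mpoly_invariant rH p -> mpoly_invariant rG p.
Proof.
move=> Ip; rewrite (pihomog_partitionE (leqnn (msize p))).
apply: invariant_sum => k _.
by apply: (invariant_homog_eq (pihomogP _ k p)); apply: invariant_pihomog.
Qed.

(** The orbit of [v] under [G] is free.  The average over [H] of a polynomial that
    is nonzero at [v] and vanishes on the rest of the orbit is an invariant of
    [H] that is supported, on this orbit, on the orbit under [H]. *)
Lemma regular_subgroup_eq : mx_faithful rG -> H = G.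
Proof.
move=> ffG; apply/val_inj/eqP; rewrite eqEsubset sHG; apply/subsetP => g Gg.
have free k : k \in G -> k != 1%g -> v *m rG k != v.
  move=> Gk; apply: contraNneq => vk.
  have := jacobian_free f_gen regular_v Gk vk.
  by rewrite -(repr_mx1 rG) => /(mx_faithful_inj ffG Gk (group1 G)) ->.
(* [t k] vanishes at the image of [v] under [k], but not at [v]; the value 1 does
   not occur for [k != 1] *)
pose t k : S := if [pick j | (v *m rG k) 0 j != v 0 j] is Some j
  then 'X_j - ((v *m rG k) 0 j)%:MP else 1.
pose delta := \prod_(k in G :\ 1%g) t k.
have delta_v : delta.@[v 0] != 0.
  rewrite rmorph_prod; apply/prodf_neq0 => k _ /=; rewrite /t.
  case: pickP => [j nj|_]; last by rewrite meval1 oner_eq0.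
  by rewrite mevalB mevalXU mevalC subr_eq0 eq_sym.
have delta_k k : k \in G -> k != 1%g -> delta.@[(v *m rG k) 0] = 0.
  move=> Gk k1; rewrite /delta (big_setD1 k) ?inE ?k1 //= mevalM.
  rewrite {1}/t; case: pickP => [j nj|none].
    by rewrite mevalB mevalXU mevalC subrr mul0r.
  case/eqP: (free k Gk k1); apply/rowP => j.
  by apply/eqP/negPn/negP => nj; have := none j; rewrite nj.
have Isum := invariant_eq (@orbit_sum_invariant _ _ _ _ rH delta).
have sumE k : (orbit_sum rH delta).@[(v *m rG k) 0] =
    \sum_(h in H) delta.@[(v *m rG k *m rG h) 0].
  by rewrite raddf_sum; apply: eq_bigr => h _; rewrite -mpoly_act_eval.
have := invariant_eval v Isum Gg; have /= := sumE 1%g.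
rewrite repr_mx1 mulmx1 => ->; rewrite sumE.
rewrite [in RHS](big_setD1 1%g (group1 H)) /= repr_mx1 mulmx1.
rewrite [in RHS]big1 ?addr0 => [E|h]; last first.
  by rewrite !inE => /andP[h1 Hh]; apply: delta_k => //; apply: (subsetP sHG).
have [h Hh nz] : exists2 h, h \in H & delta.@[(v *m rG g *m rG h) 0] != 0.
  apply/exists_inP; apply: contraNT delta_v => /exists_inPn none.
  by rewrite -E big1 // => h /none /negPn /eqP.
have Gh := subsetP sHG _ Hh.
have gh1 : (g * h)%g = 1%g.
  apply/eqP; apply: contraNT nz => ne; rewrite -mulmxA -repr_mxM //.
  by rewrite delta_k ?groupM.
by rewrite -(mulgK h g) gh1 mul1g groupV.
Qed.

End RegularElements.

(** * Reflections *)

Section Reflections.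
Variables (C : numFieldType) (gT : finGroupType) (W : {group gT}) (n : nat).
Variable rW : mx_representation C W n.
Implicit Types (r : gT) (v : 'rV[C]_n) (c : 'cV[C]_n).

Lemma rfix_mx1P v r : reflect (v *m rW r = v) (v <= rfix_mx rW [set r])%MS.
Proof.
apply: (iffP (rfix_mxP _)) => [fixv|fixv x /set1P-> //].
by apply: fixv; rewrite inE.
Qed.

Lemma mxrank_sub1 r : \rank (rW r - 1%:M) = (n - \rank (rfix_mx rW [set r]))%N.
Proof.
have eqK : (rfix_mx rW [set r] :=: kermx (rW r - 1%:M))%MS.
  apply/eqmxP/andP; split; apply/row_subP => i.
    apply/sub_kermxP; rewrite mulmxBr mulmx1; apply/eqP; rewrite subr_eq0.
    by apply/eqP/rfix_mx1P/row_sub.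
  apply/rfix_mx1P; apply/eqP; rewrite -subr_eq0 -{2}[row i _]mulmx1 -mulmxBr.
  by apply/eqP/sub_kermxP/row_sub.
by rewrite eqK mxrank_ker subKn ?rank_leq_row.
Qed.

Lemma root_of_reflection r : r \in reflections rW -> exists c, root_of rW r c.
Proof.
rewrite inE -mxrank_sub1 => /andP[_ /eqP rk1]; set A := _ - _ in rk1.
have [c [u AE]] : exists c : 'cV_n, exists u : 'rV_n, A = c *m u.
  (* the bases of [A] have inner dimension [\rank A], which is only provably 1 *)
  have : forall k (B : 'M[C]_(n, k)) (D : 'M[C]_(k, n)), k = 1%N ->
      exists c : 'cV_n, exists u : 'rV_n, B *m D = c *m u.
    by move=> k B D k1; subst k; exists B, D.
  by move=> /(_ _ (col_base A) (row_base A) rk1); rewrite mulmx_base.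
exists c; split.
  by apply: contra_eqN rk1 => /eqP c0; rewrite AE c0 mul0mx mxrank0.
exists u.
  by apply: contra_eqN rk1 => /eqP u0; rewrite AE u0 mulmx0 mxrank0.
by rewrite -AE addrC subrK.
Qed.

Lemma reflection_root_of r c : r \in W -> root_of rW r c -> r \in reflections rW.
Proof.
move=> Wr [nzc [u nzu rE]]; rewrite inE Wr -mxrank_sub1 rE addrAC subrr add0r.
rewrite eqn_leq (leq_trans (mxrankM_maxl _ _)) ?rank_leq_col //= lt0n mxrank_eq0.
apply: contraNneq nzu => cu0.
have [i nzi] := cV_neq0 nzc.
apply/eqP/rowP => j; have /matrixP /(_ i j) := cu0; rewrite !mxE big_ord1.
by move/eqP; rewrite mulf_eq0 (negPf nzi) => /eqP.
Qed.

Lemma reflectionV r : r \in reflections rW -> (r^-1)%g \in reflections rW.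
Proof.
have fixV s v : s \in W -> v *m rW s = v -> v *m rW (s^-1)%g = v.
  by move=> Ws E; rewrite -{1}E repr_mxK.
rewrite !inE groupV => /andP[Wr /eqP rk]; rewrite Wr -rk; apply/eqP; congr (_ - _)%N.
apply: eqmx_rank; apply/andP; split; apply/row_subP => i; apply/rfix_mx1P.
  by rewrite -[r in rW r]invgK; apply: fixV; rewrite ?groupV //; apply/rfix_mx1P/row_sub.
by apply: fixV => //; apply/rfix_mx1P/row_sub.
Qed.

End Reflections.

(** * Coxeter numbers *)

Section CoxeterNumber.
Variables (C : numClosedFieldType) (gT : finGroupType) (W : {group gT}) (n : nat).
Variable rW : mx_representation C W n.
Implicit Types (r g h : gT) (u v : 'rV[C]_n).

Definition herm u v : C :=
  \sum_(g in W) \sum_k (u *m rW g) 0 k * ((v *m rW g) 0 k)^*.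

Lemma hermDl u1 u2 v : herm (u1 + u2) v = herm u1 v + herm u2 v.
Proof.
rewrite -big_split; apply: eq_bigr => g _; rewrite -big_split.
by apply: eq_bigr => k _; rewrite /= mulmxDl mxE mulrDl.
Qed.

Lemma hermZl a u v : herm (a *: u) v = a * herm u v.
Proof.
rewrite mulr_sumr; apply: eq_bigr => g _; rewrite mulr_sumr.
by apply: eq_bigr => k _; rewrite -scalemxAl mxE mulrA.
Qed.

Lemma hermBl u1 u2 v : herm (u1 - u2) v = herm u1 v - herm u2 v.
Proof. by rewrite -scaleN1r hermDl hermZl mulN1r. Qed.

Lemma herm_conj u v : (herm u v)^* = herm v u.
Proof.
rewrite rmorph_sum; apply: eq_bigr => g _; rewrite rmorph_sum.
by apply: eq_bigr => k _; rewrite rmorphM /= conjCK mulrC.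
Qed.

Lemma hermBr u v1 v2 : herm u (v1 - v2) = herm u v1 - herm u v2.
Proof. by rewrite -herm_conj hermBl rmorphB /= !herm_conj. Qed.

Lemma herm_suml (I : Type) (s : seq I) (P : pred I) (F : I -> 'rV_n) v :
  herm (\sum_(i <- s | P i) F i) v = \sum_(i <- s | P i) herm (F i) v.
Proof.
elim/big_rec2: _ => [|i y1 y2 _ <-]; last by rewrite hermDl.
by rewrite -(scale0r 0) hermZl mul0r.
Qed.

Lemma herm_inv u v h : h \in W -> herm (u *m rW h) (v *m rW h) = herm u v.
Proof.
move=> Wh; rewrite [RHS](reindex_inj (mulgI h)) /=; apply: eq_big => g.
  by rewrite groupMl.
by move=> Wg; apply: eq_bigr => k _; rewrite repr_mxM // !mulmxA.
Qed.

Lemma herm_ge0 v : 0 <= herm v v.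
Proof. by do 2!(apply: sumr_ge0 => ? _); apply: mul_conjC_ge0. Qed.

Lemma herm_eq0 v : herm v v = 0 -> v = 0.
Proof.
move=> /eqP; rewrite psumr_eq0 => [/allP /(_ 1%g)|g _]; last first.
  by apply: sumr_ge0 => k _; apply: mul_conjC_ge0.
rewrite mem_index_enum group1 repr_mx1 mulmx1 => /(_ isT).
rewrite psumr_eq0 => [/allP v0|k _]; last exact: mul_conjC_ge0.
apply/rowP => k; rewrite mxE; apply/eqP; rewrite -mul_conjC_eq0.
by apply: v0; rewrite mem_index_enum.
Qed.

(** Since [W] acts by isometries, [herm (v - v *m rW r) v] and its conjugate,
    which is the value for the inverse of [r], add up to the squared norm of
    [v - v *m rW r]. *)
Lemma herm_sum_sub (Y : {set gT}) v : Y \subset W ->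
    (forall r, r \in Y -> (r^-1)%g \in Y) ->
  2 * herm (\sum_(r in Y) (v - v *m rW r)) v =
    \sum_(r in Y) herm (v - v *m rW r) (v - v *m rW r).
Proof.
move=> /subsetP sYW YV; rewrite herm_suml mulr_natl mulr2n.
have inY r : ((r^-1)%g \in Y) = (r \in Y).
  by apply/idP/idP => /YV //; rewrite invgK.
rewrite {2}(reindex_inj invg_inj) /= (eq_bigl _ _ inY) -big_split /=.
apply: eq_bigr => r /sYW Wr.
have -> : herm (v - v *m rW (r^-1)%g) v = herm v (v - v *m rW r).
  by rewrite hermBl hermBr -(herm_inv (v *m _) v Wr) repr_mxKV.
rewrite !(hermBl, hermBr) (herm_inv v v Wr).
by ring.
Qed.

Lemma herm_sum_sub_ge0 (Y : {set gT}) v : Y \subset W ->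
    (forall r, r \in Y -> (r^-1)%g \in Y) ->
  0 <= herm (\sum_(r in Y) (v - v *m rW r)) v.
Proof.
move=> sYW YV; rewrite -(pmulr_rge0 _ (ltr0Sn C 1)) herm_sum_sub //.
by apply: sumr_ge0 => r _; apply: herm_ge0.
Qed.

Lemma herm_sum_sub_eq0 (Y : {set gT}) v : Y \subset W ->
    (forall r, r \in Y -> (r^-1)%g \in Y) ->
    \sum_(r in Y) (v - v *m rW r) = 0 ->
  forall r, r \in Y -> v *m rW r = v.
Proof.
move=> sYW YV s0 r Yr; apply/esym/eqP; rewrite -subr_eq0; apply/eqP.
apply: herm_eq0; have /esym/eqP := herm_sum_sub v sYW YV.
rewrite s0 -(scale0r 0) hermZl mul0r mulr0 psumr_eq0 => [/allP|? _]; last exact: herm_ge0.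
by move=> /(_ r); rewrite mem_index_enum Yr => /(_ isT) /eqP.
Qed.

Lemma coxeter_number_mono (H : {group gT}) (sHW : H \subset W) (U : 'M[C]_n) (c c' : C) :
    irreducible_reflection_group rW -> mxsimple (subg_repr rW sHW) U ->
    is_coxeter_number rW W 1%:M c -> is_coxeter_number rW H U c' ->
  c' <= c /\ (c' = c <-> H = W).
Proof.
move=> [ffW irrW genW] [modU nzU _] Hc Hc'.
have sRW : reflections rW \subset W by apply/subsetP => r; rewrite inE => /andP[].
pose Y := reflections rW :\: H.
have sYW : Y \subset W by apply: subset_trans sRW; apply: subsetDl.
have YV r : r \in Y -> (r^-1)%g \in Y.
  by rewrite !in_setD groupV => /andP[-> /reflectionV ->].
have sumY v : (v <= U)%MS -> \sum_(r in Y) (v - v *m rW r) = (c - c') *: v.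
  move=> Uv; rewrite scalerBl -Hc ?submx1 // -Hc' // !mulmx_sumr.
  rewrite (setIidPr sRW) [X in _ = X - _](big_setID H) /=.
  rewrite [reflections rW :&: H]setIC addrAC subrr add0r.
  by apply: eq_bigr => r _; rewrite mulmxBr mulmx1.
pose v := nz_row U; have Uv : (v <= U)%MS by apply: nz_row_sub.
have nzv : v != 0 by rewrite nz_row_eq0.
have v_gt0 : 0 < herm v v.
  by rewrite lt0r herm_ge0 andbT; apply: contraNneq nzv => /herm_eq0 ->.
split; last split=> [cc'|HW].
- rewrite -subr_ge0 -(pmulr_lge0 _ v_gt0) -hermZl -sumY //.
  exact: herm_sum_sub_ge0.
- (* the reflections outside [H] fix [U] pointwise, so [U] is [W]-stable *)
  have fixU r : r \in Y -> U *m rW r = U.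
    move=> Yr; apply/row_matrixP => i; rewrite row_mul.
    apply: (herm_sum_sub_eq0 sYW YV) => //.
    by rewrite sumY ?row_sub // cc' subrr scale0r.
  have modWU : mxmodule rW U.
    rewrite /mxmodule -{1}genW gen_subG; apply/subsetP => r Rr.
    rewrite inE (subsetP sRW) //=; have [Hr|nHr] := boolP (r \in H).
      exact: (mxmoduleP modU).
    by rewrite fixU ?submx_refl // inE nHr.
  have [_ _ minW] := irrW; have U1 := minW U modWU (submx1 _) nzU.
  have sRH : reflections rW \subset H.
    apply/subsetP => r Rr; apply: contraTT (Rr) => nHr.
    have Yr : r \in Y by rewrite inE nHr.
    rewrite inE negb_and -mxrank_sub1; apply/orP; right.
    suff -> : rW r = 1%:M by rewrite subrr mxrank0.
    have [B BE] := submxP U1.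
    by rewrite -[rW r]mul1mx BE -mulmxA fixU.
  apply/val_inj/eqP; rewrite eqEsubset sHW /=.
  by rewrite -{1}genW gen_subG.
subst H; apply/eqP; rewrite eq_sym -subr_eq0; apply: contraTT nzv => nz.
rewrite negbK; have := sumY v Uv; rewrite big1 => [/esym/eqP|r].
  by rewrite scaler_eq0 (negPf nz).
by rewrite inE => /andP[nWr /(subsetP sRW)]; rewrite (negPf nWr).
Qed.

End CoxeterNumber.

(** * Coxeter elements *)

Lemma coxeter_element_notin (C : numFieldType) (gT : finGroupType) (W H : {group gT})
    (n : nat) (rW : mx_representation C W n) (w : gT) :
    mx_faithful rW -> <<reflections rW>>%g = W -> coxeter_element rW w ->
    reflection_subgroup rW H -> H <> W ->
  w \notin H.
Proof.
move=> ffW genW [d [d_sorted [f [f_homog f_indep f_gen]]]].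
move=> [Ww [zeta prim_zeta [v reg_v vw]]] [sHW genH] neHW; apply/negP => Hw.
apply: neHW.
have rootW r : r \in reflections rW -> exists c, root_of rW r c.
  exact: root_of_reflection.
(* a zero of a root form is fixed by the reflection of that root form *)
have regJ : \det (map_mx (meval (v 0)) (jacobian f)) != 0.
  apply: (jacobian_regular f_homog f_indep f_gen genW rootW) => c [r Wr rc].
  have := reg_v r (reflection_root_of Wr rc); apply: contraNneq => vc0.
  have [_ [u _ rE]] := rc; apply/rfix_mx1P; rewrite rE mulmxDr mulmx1 mulmxA.
  by rewrite [v *m c]mx11_scalar vc0 raddf0 mul0mx addr0.
have le_d i : (tnth d i <= last 0%N d)%N.
  rewrite (tnth_nth 0%N) -nth_last size_tuple; have lt_i := ltn_ord i.
  by apply: (sorted_leq_nth leq_trans leqnn) => //; rewrite ?inE ?size_tuple; lia.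
apply: (regular_subgroup_eq (sHG := sHW) f_homog f_indep f_gen genH _
  Hw prim_zeta vw le_d regJ ffW).
by move=> r /setIP[_ /rootW].
Qed.

Unset Implicit Arguments.

Theorem theoremA1 (R : realType) (gT : finGroupType) (W : {group gT}) (n : nat)
    (rW : mx_representation R[i] W n) (irrW : irreducible_reflection_group rW) :
  (forall (W' : {group gT}) (sW'W : W' \subset W) (U : 'M[R[i]]_n) (h h' : R[i]),
     irreducible_reflection_subgroup rW sW'W U ->
     is_coxeter_number rW W 1%:M h ->
     is_coxeter_number rW W' U h' ->
     h' <= h /\ (h' = h <-> W' = W))
  /\
  (well_generated rW ->
   forall w : gT, coxeter_element rW w ->
   forall W' : {group gT}, reflection_subgroup rW W' -> W' <> W -> w \notin W').
Proof.
have [ffW _ genW] := irrW; split=> [W' sW'W U h h' [_ _ simpU]|_ w cox_w W'].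
  exact: coxeter_number_mono irrW simpU.
exact: coxeter_element_notin ffW genW cox_w.
Qed.
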